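(* Let $T>0$, let $(U,d_U)$ be a compact metric space, and let $f:\mathbb{R}^d\times U\to\mathbb{R}^d$ satisfy: (i) $f$ is continuous and there exists $m>0$ such that $|f(x,u)|\le m(1+|x|)$ for all $(x,u)\in\mathbb{R}^d\times U$; (ii) for each compact set $K\subset\mathbb{R}^d$ there exists $\ell_K>0$ such that $|f(x,u)-f(y,u)|\le \ell_K|x-y|$ for all $x,y\in K$ and $u\in U$. Let $\mathcal{K}_{(\tau,t)}$ denote the associated set-valued Koopman operators on $\mathcal{X}=C^0_c(\mathbb{R}^d,\mathbb{C})$, and let $\varphi\in\mathcal{X}$. Then a function $(\tau,t)\in[0,T]\times[0,T]\mapsto\psi_{(\tau,t)}\in\mathcal{X}$ is a measurable selection in the set-valued map $(\tau,t)\in[0,T]\times[0,T]\rightrightarrows\mathcal{K}_{(\tau,t)}(\varphi)$ if and only if there exists an $\mathcal{L}^2$-measurable map $(\tau,t)\in[0,T]\times[0,T]\mapsto u_{\tau,t}(\cdot)\in\mathcal{U}$ such that $$\psi_{(\tau,t)}=\varphi\circ\Phi^{u_{\tau,t}}_{(\tau,t)}$$ for $\mathcal{L}^2$-almost every $(\tau,t)\in[0,T]\times[0,T]$.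
   Context: $\mathcal{L}^k$ is the Lebesgue measure on $\mathbb{R}^k$. $\mathcal{X}:=C^0_c(\mathbb{R}^d,\mathbb{C})$ carries the supremum norm. $\mathcal{U}$ is the set of $\mathcal{L}^1$-measurable maps $u:[0,T]\to U$, endowed with the distance $d_{\mathcal{U}}(u,v):=\int_0^T d_U(u(t),v(t))\,dt$ (functions equal almost everywhere being identified), for which it is a Polish space. For $u(\cdot)\in\mathcal{U}$, the controlled flow $(\Phi^u_{(\tau,t)})_{\tau,t\in[0,T]}\subset C^0(\mathbb{R}^d,\mathbb{R}^d)$ is the unique solution of $\Phi^u_{(\tau,t)}(x)=x+\int_\tau^t f(\Phi^u_{(\tau,s)}(x),u(s))\,ds$ for all $\tau,t\in[0,T]$, $x\in\mathbb{R}^d$. The set-valued Koopman operators are $$\mathcal{K}_{(\tau,t)}(\varphi):=\{\varphi\circ\Phi^u_{(\tau,t)} ~:~ u(\cdot)\in\mathcal{U}\}\subset\mathcal{X}.$$ A map into a metric space is $\mathcal{L}^2$-measurable if preimages of open sets are Lebesgue-measurable. A measurable selection of a set-valued map $F$ on $[0,T]\times[0,T]$ is an $\mathcal{L}^2$-measurable map $g$ with $g(\tau,t)\in F(\tau,t)$ for $\mathcal{L}^2$-almost every $(\tau,t)$. *)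

(* Defs.v *)
From HB Require Import structures.
From mathcomp Require Import all_boot all_order all_algebra.
From mathcomp Require Import generic_quotient complex.
From mathcomp Require Import all_classical all_reals all_analysis.
From mathcomp Require Import measurable_realfun.

Set Implicit Arguments.
Unset Strict Implicit.
Unset Printing Implicit Defensive.

Import Order.TTheory GRing.Theory Num.Theory.
Import numFieldNormedType.Exports.

Local Open Scope classical_set_scope.
Local Open Scope ring_scope.

(* The real line with the sigma-algebra of Lebesgue-measurable sets, as opposed
   to the Borel sigma-algebra of measurableTypeR. *)
Notation lebesgueType R := (caratheodory_type (@wlength R idfun)^*%mu).

Section lebesgue.
Context {R : realType}.

Definition leb1 : {measure set (lebesgueType R) -> \bar R} :=
  @completed_lebesgue_measure R.

Definition leb2 :
    {measure set (measurableTypeR R * measurableTypeR R) -> \bar R} :=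
  (@lebesgue_measure R \x @lebesgue_measure R)%E.

Definition time_square (T : R) : set (R * R) := `[0, T] `*` `[0, T].

(* Functions on [0, T] x [0, T] are represented by total functions, whose values
   off the square are never looked at. *)
Definition leb2_measurable (T : R) (S : topologicalType) (g : R * R -> S) :=
  forall O : set S, open O ->
    completed_algebra_gen leb2 (time_square T `&` g @^-1` O).

Definition measurable_selection (T : R) (S : topologicalType)
    (F : R -> R -> set S) (g : R * R -> S) :=
  leb2_measurable T g /\
  {ae leb2, forall p, time_square T p -> F p.1 p.2 (g p)}.

Definition oriented_int (a b : R) (g : R -> R) : R :=
  if a <= b then Rintegral leb1 `[a, b] g else - Rintegral leb1 `[b, a] g.

Definition enorm d (x : 'rV[R]_d) : R := Num.sqrt (\sum_i x ord0 i ^+ 2).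

Lemma measurable_itv_lebesgue (i : interval R) :
  measurable ([set` i] : set (lebesgueType R)).
Proof.
rewrite -(@completed_caratheodory_measurable R).
rewrite g_sigma_completed_algebra_genE.
exists [set` i]; first exact: (@measurable_itv R).
by exists set0; [exact: negligible_set0 | rewrite setU0].
Qed.

Lemma leb1_itv_lty (a b : R) : (leb1 `[a, b]%classic < +oo)%E.
Proof.
have -> : leb1 `[a, b]%classic = lebesgue_measure (`[a, b]%classic : set R).
  rewrite /leb1 /= /completed_lebesgue_measure.
  rewrite /completed_lebesgue_stieltjes_measure /completed_measure_extension.
  by rewrite /lebesgue_measure /lebesgue_stieltjes_measure /measure_extension.
by rewrite lebesgue_measure_itv /=; case: ifP => _; rewrite ?ltry // -EFinB ltry.
Qed.

End lebesgue.

Section compactly_supported.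
Context {R : realType} {d : nat}.

(* [R[i]^o] is [R[i]] viewed as a normed module over itself, which gives it its
   usual topology. *)
Record compactly_supported := CompactlySupported {
  csfun :> 'rV[R]_d -> R[i] ;
  cs_continuous : continuous (csfun : 'rV[R]_d -> R[i]^o) ;
  cs_compact : compact (closure [set x | csfun x != 0]) }.

HB.instance Definition _ := gen_eqMixin compactly_supported.
HB.instance Definition _ := gen_choiceMixin compactly_supported.

Local Notation normc := (@ComplexField.Normc.normc R).

Definition cs_dist (f g : compactly_supported) : R :=
  sup (range (fun x => normc (f x - g x))).

End compactly_supported.
Arguments compactly_supported : clear implicits.

Section cs_metric.
Context {R : realType} {d : nat}.
Local Notation cs := (compactly_supported R d).
Local Notation normc := (@ComplexField.Normc.normc R).

Lemma cs_eq (f g : cs) : (f : _ -> _) = g -> f = g.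
Proof.
case: f g => [f cf kf] [g cg kg] /= fg.
by subst g; congr CompactlySupported; exact: Prop_irrelevance.
Qed.

Lemma normc_continuous : continuous (normc : R[i]^o -> R).
Proof.
move=> z; have FF : Filter (nbhs (z : R[i]^o)) := nbhs_filter _.
apply/cvgrPdist_lt => e e0.
apply/(@nbhs_ballP _ R[i]^o); exists (e%:C)%C => /=; first by rewrite ltcR.
move=> w; rewrite /ball /=.
rewrite -[X in X < _]/((normc (z - w))%:C)%C ltcR; apply: le_lt_trans.
rewrite ler_distl lerBlDr; apply/andP; split.
  by have := le_normcD (w - z) z; rewrite subrK -opprB normcN addrC.
by have := le_normcD (z - w) w; rewrite subrK addrC.
Qed.

Lemma cs_bounded (f : cs) : exists M, forall x, normc (f x) <= M.
Proof.
have cf : continuous (normc \o f : 'rV[R]_d -> R).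
  move=> x; apply: (@continuous_comp _ R[i]^o _ f normc).
    exact: cs_continuous.
  exact: normc_continuous.
have /compact_bounded[M [_ /(_ (M + 1))]] :
    compact ((normc \o f) @` closure [set x | f x != 0]).
  by apply: continuous_compact; [exact: continuous_subspaceT|exact: cs_compact].
rewrite ltrDl ltr01 => /(_ isT) hM.
exists (Num.max 0 (M + 1)) => x.
have [fx0|fx0] := eqVneq (f x) 0.
  by rewrite fx0 ComplexField.Normc.normc0 le_max lexx.
rewrite le_max; apply/orP; right; apply: le_trans (hM (normc (f x)) _).
  exact: ler_norm.
by exists x => //; exact: subset_closure.
Qed.

Lemma cs_has_sup (f g : cs) : has_sup (range (fun x => normc (f x - g x))).
Proof.
split; first by exists (normc (f 0 - g 0)); exists 0.
have [M hM] := cs_bounded f; have [N hN] := cs_bounded g.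
exists (M + N) => _ [x _ <-].
apply: le_trans (le_normcD _ _) _; rewrite normcN; exact: lerD.
Qed.

Lemma cs_dist_ub (f g : cs) x : normc (f x - g x) <= cs_dist f g.
Proof. by apply: ub_le_sup; [exact: (cs_has_sup f g).2 | exists x]. Qed.

Let cs_distxx (f : cs) : cs_dist f f = 0.
Proof.
rewrite /cs_dist.
have -> : range (fun x => normc (f x - f x)) = [set 0]; last by rewrite sup1.
apply/seteqP; split => [_ [x _ <-]|_ ->] /=.
  by rewrite subrr ComplexField.Normc.normc0.
by exists 0 => //; rewrite subrr ComplexField.Normc.normc0.
Qed.

Let cs_dist_pos (f g : cs) : cs_dist f g = 0 -> f = g.
Proof.
move=> fg; apply: cs_eq; apply/funext => x.
apply/eqP; rewrite -subr_eq0; apply/eqP/ComplexField.Normc.eq0_normc/eqP.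
rewrite eq_le -{1}fg cs_dist_ub /=.
by case: (f x - g x) => a b; exact: sqrtr_ge0.
Qed.

Let cs_dist_sym (f g : cs) : cs_dist f g = cs_dist g f.
Proof.
rewrite /cs_dist; congr (sup _).
by apply: eq_imagel => x _; rewrite -normcN opprB.
Qed.

Let cs_dist_tri (g f h : cs) : cs_dist f h <= cs_dist f g + cs_dist g h.
Proof.
apply: ge_sup; first exact: (cs_has_sup f h).1.
move=> _ [x _ <-]; rewrite -[f x](subrK (g x)) -addrA.
by rewrite (le_trans (le_normcD _ _)) // lerD // cs_dist_ub.
Qed.

HB.instance Definition _ := isMetric.Build R cs
  cs_distxx cs_dist_pos cs_dist_sym cs_dist_tri.

End cs_metric.

Section controls.
Context {R : realType} {U : metricType R}.

Record control (T : R) := Control {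
  control_fun :> R -> U ;
  control_measurable : forall O : set U, open O ->
    measurable (`[0, T] `&` control_fun @^-1` O : set (lebesgueType R)) }.

HB.instance Definition _ T := gen_eqMixin (control T).
HB.instance Definition _ T := gen_choiceMixin (control T).

Definition control_rel (T : R) (u v : control T) : bool :=
  `[< ae_eq leb1 `[0, T]%classic u v >].

Let control_rel_refl T : reflexive (@control_rel T).
Proof. by move=> u; apply/asboolP; exact: ae_eq_refl. Qed.

Let control_rel_sym T : symmetric (@control_rel T).
Proof. by move=> u v; apply/asboolP/asboolP => /ae_eq_sym. Qed.

Let control_rel_trans T : transitive (@control_rel T).
Proof.
by move=> v u w /asboolP uv /asboolP vw; apply/asboolP; exact: ae_eq_trans vw.
Qed.

Definition control_equiv T :=
  EquivRel _ (@control_rel_refl T) (@control_rel_sym T) (@control_rel_trans T).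

(* Compactness of [U] is what makes the distance finite and additive, so it is
   recorded in the type to let the metric structure be inferred. *)
Definition controls (cU : compact [set: U]) (T : R) : Type :=
  {eq_quot (@control_equiv T)}%qT.

HB.instance Definition _ cU T := Choice.on (controls cU T).
HB.instance Definition _ cU T := EqQuotient.on (controls cU T).

Definition controls_dist cU T (u v : controls cU T) : R :=
  Rintegral leb1 `[0, T] (fun t => mdist (repr u t) (repr v t)).

End controls.
Arguments control {R} U T.

Section controls_metric.
Context {R : realType} {U : metricType R}.
Variables (cU : compact [set: U]) (T : R).
Local Notation D := (`[0, T]%classic : set (lebesgueType R)).


Lemma measurable_mdist (u v : control U T) :
  measurable_fun D (fun t => mdist (u t) (v t)).
Proof.
pose U' : pseudoPMetricType R := HB.pack U (PseudoMetric.on U) (isPointed.Build U (u 0)).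
have [B cB [oB bB]] : @second_countable U'.
  exact: (@compact_second_countable R U').
apply: (measurability _ (RGenInftyO.measurableE R)) => _ [_ [r ->] <-].
pose P := [set p : set U * set U | (B `*` B) p /\
  forall x y, p.1 x -> p.2 y -> mdist x y < r].
have -> : D `&` (fun t => mdist (u t) (v t)) @^-1` `]-oo, r[%classic =
    \bigcup_(p in P) ((D `&` u @^-1` p.1) `&` (D `&` v @^-1` p.2)).
  apply/seteqP; split => t /=.
    rewrite in_itv /= => -[Dt uvr].
    pose e := (r - mdist (u t) (v t)) / 2.
    have e0 : 0 < e by rewrite divr_gt0 ?subr_gt0.
    have [A [BA Au] Ae] := bB (u t) _ (nbhsx_ballx (u t : U') e e0).
    have [C [BC Cv] Ce] := bB (v t) _ (nbhsx_ballx (v t : U') e e0).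
    exists (A, C) => //; split => // x y /= /Ae /= xe /Ce /= ye.
    move: xe ye; rewrite /= !ballEmdist /= => xe ye.
    apply: le_lt_trans (metric_triangle _ (u t) _) _.
    apply: (@le_lt_trans _ _ (mdist x (u t) + (mdist (u t) (v t) + mdist (v t) y))).
      by rewrite lerD2l metric_triangle.
    have -> : r = e + (mdist (u t) (v t) + e).
      by rewrite addrCA -splitr addrC subrK.
    by rewrite ltrD // ?ltrD2l // metric_sym.
  by move=> [[A C] /= [_ ACr]] [[Dt Au] [_ Cv]]; split => //; rewrite in_itv /= ACr.
rewrite bigcup_set_type; apply: countable_bigcupT_measurable.
  apply: (@sub_countable _ _ _ (B `*` B)); last exact: countableX.
  apply: card_le_trans (subset_card_le (_ : P `<=` _)); last by move=> p [].
  by have := card_setT P; rewrite card_eq_le => /andP[].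
move=> [[A C] /= /set_mem [[/= BA BC] _]].
by apply: measurableI; apply: control_measurable; [exact: (oB A)|exact: (oB C)].
Qed.

Let controls_distxx (u : controls cU T) : controls_dist u u = 0.
Proof.
rewrite /controls_dist /Rintegral integral0_eq // => t _.
by rewrite mdistxx.
Qed.

Let controls_dist_sym (u v : controls cU T) :
  controls_dist u v = controls_dist v u.
Proof. by apply: eq_Rintegral => t _; exact: metric_sym. Qed.

Lemma integral_mdist_fin (u v : control U T) :
  (\int[leb1]_(t in D) (mdist (u t) (v t))%:E \is a fin_num)%E.
Proof.
have mD := @measurable_itv_lebesgue R `[0, T].
have mm : measurable_fun D (fun t => (mdist (u t) (v t))%:E).
  by apply/measurable_EFinP; exact: measurable_mdist.
have [M hM] : exists M, forall x, mdist (u 0) x < M.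
  have /compact_near_coveringP/(_ R +oo%R) := cU.
  move=> /(_ (fun M x => mdist (u 0) x < M)) [|M [_ hM]]; last first.
    by exists (M + 1) => x; apply: hM => //; rewrite ltrDl.
  move=> x _; exists (ball x 1, [set i | mdist (u 0) x + 1 < i]).
    by split => /=; [exact: nbhsx_ballx|exact/nbhs_pinfty_gt/num_real].
  move=> [y i] /= []; rewrite ballEmdist /= => xy.
  apply: lt_trans; apply: le_lt_trans (metric_triangle _ x _) _.
  by rewrite ltrD2l.
rewrite ge0_fin_numE; last by apply: integral_ge0 => t _; rewrite lee_fin mdist_ge0.
apply: (@le_lt_trans _ _ (\int[leb1]_(t in D) (cst (M + M)%:E t))%E).
  apply: ge0_le_integral => //; first by move=> *; rewrite lee_fin mdist_ge0.
  move=> t _ /=; rewrite lee_fin; apply: le_trans (metric_triangle _ (u 0) _) _.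
  by rewrite lerD // ltW // metric_sym.
rewrite integral_cst //; apply: lte_mul_pinfty => //; last exact: leb1_itv_lty.
by rewrite lee_fin addr_ge0 // ltW // (le_lt_trans (mdist_ge0 (u 0) (u 0))).
Qed.

Let controls_dist_pos (u v : controls cU T) : controls_dist u v = 0 -> u = v.
Proof.
move=> /eqP; rewrite /controls_dist /Rintegral fine_eq0 ?integral_mdist_fin //.
move=> /eqP uv0; rewrite -[u]reprK -[v]reprK; apply/eqmodP/asboolP.
have mD := @measurable_itv_lebesgue R `[0, T].
have /(ae_eq_integral_abs leb1 mD)[h _] : measurable_fun D (EFin \o fun t => mdist (repr u t) (repr v t)).
  by apply/measurable_EFinP; exact: measurable_mdist.
have : ae_eq leb1 D (EFin \o (fun t => mdist (repr u t) (repr v t))) (cst 0%E).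
  apply: h; rewrite -[RHS]uv0; apply: eq_integral => t _.
  by rewrite /= ger0_norm // mdist_ge0.
by apply: filterS => t /= h' /h' [/mdist_positivity].
Qed.

Let controls_dist_tri (v u w : controls cU T) :
  controls_dist u w <= controls_dist u v + controls_dist v w.
Proof.
rewrite /controls_dist /Rintegral -fineD ?integral_mdist_fin //.
have mD := @measurable_itv_lebesgue R `[0, T].
have mm (a b : control U T) :
    measurable_fun D (fun t => (mdist (a t) (b t))%:E).
  by apply/measurable_EFinP; exact: measurable_mdist.
rewrite -ge0_integralD //; [|by move=> *; rewrite lee_fin mdist_ge0..].
apply: fine_le; first exact: integral_mdist_fin.
  rewrite ge0_integralD //; [|by move=> *; rewrite lee_fin mdist_ge0..].
  by rewrite fin_numD !integral_mdist_fin.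
apply: ge0_le_integral; first exact: mD.
- by move=> t _; rewrite lee_fin mdist_ge0.
- exact: mm.
- by apply: emeasurable_funD; exact: mm.
- by move=> t _; rewrite -EFinD lee_fin metric_triangle.
Qed.

HB.instance Definition _ := isMetric.Build R (controls cU T)
  controls_distxx controls_dist_pos controls_dist_sym controls_dist_tri.


Lemma mdist_pi (u v : control U T) :
  mdist (\pi_(controls cU T) u)%qT (\pi_(controls cU T) v)%qT =
  Rintegral leb1 `[0, T] (fun t => mdist (u t) (v t)).
Proof.
have mD := @measurable_itv_lebesgue R `[0, T].
have repr_ae (w : control U T) : ae_eq leb1 D (repr (\pi_(controls cU T) w)%qT) w.
  have /eqmodP/asboolP // : (repr (\pi_(controls cU T) w) = w %[mod controls cU T])%qT.
  by rewrite reprK.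
congr fine; apply: ge0_ae_eq_integral; first exact: mD.
- by apply/measurable_EFinP; exact: measurable_mdist.
- by apply/measurable_EFinP; exact: measurable_mdist.
- by move=> t _; rewrite lee_fin mdist_ge0.
- by move=> t _; rewrite lee_fin mdist_ge0.
- by apply: filterS2 (repr_ae u) (repr_ae v) => t /= hu hv Dt; rewrite hu // hv.
Qed.

End controls_metric.

Section flow.
Context {R : realType} {U : metricType R} {d : nat}.
Variables (f : 'rV[R]_d -> U -> 'rV[R]_d) (T : R).

Definition is_flow (u : R -> U) (Phi : R -> R -> 'rV[R]_d -> 'rV[R]_d) :=
  forall tau t, `[0, T]%classic tau -> `[0, T]%classic t ->
  continuous (Phi tau t) /\
  forall x,
    (forall i, leb1.-integrable `[0, T]
       (fun s => (f (Phi tau s x) (u s) ord0 i)%:E)) /\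
    Phi tau t x =
      x + \row_i oriented_int tau t (fun s => f (Phi tau s x) (u s) ord0 i).

(* The hypotheses on [f] guarantee a flow, unique on [0, T] x [0, T]. *)
Definition flow (u : R -> U) : R -> R -> 'rV[R]_d -> 'rV[R]_d :=
  @xget (R -> R -> 'rV[R]_d -> 'rV[R]_d) (fun _ _ x => x)
    [set Phi | is_flow u Phi].

Let is_flow_ae_sub (u v : R -> U) (Phi : R -> R -> 'rV[R]_d -> 'rV[R]_d) :
  ae_eq leb1 `[0, T]%classic u v -> is_flow u Phi -> is_flow v Phi.
Proof.
move=> uv uPhi tau t Ttau Tt; have [cPhi hPhi] := uPhi _ _ Ttau Tt.
split => // x; have [iPhi ->] := hPhi x.
have mD i := @measurable_itv_lebesgue R i.
pose F (w : R -> U) i (s : lebesgueType R) := (f (Phi tau s x) (w s) ord0 i)%:E.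
have FF i : ae_eq leb1 (`[0, T]%classic : set (lebesgueType R)) (F u i) (F v i).
  by apply: filterS uv => s /= uvs Ts; rewrite /F uvs.
have cmu : measure_is_complete (@leb1 R) by exact: completed_lebesgue_measure_is_complete.
have mF i : measurable_fun (`[0, T]%classic : set (lebesgueType R)) (F v i).
  by apply: (ae_measurable_fun cmu (FF i)); exact: (measurable_int leb1 (iPhi i)).
split.
  move=> i; apply/integrableP; split; first exact: mF.
  have /integrableP[mu_ ltu] := iPhi i.
  suff -> : (\int[leb1]_(s in `[0%R, T]) `|F v i s| =
             \int[leb1]_(s in `[0%R, T]) `|F u i s|)%E by [].
  apply: ae_eq_integral; first exact: mD.
  - by apply: measurableT_comp => //; exact: mF.
  - exact: measurableT_comp.
  - by apply: filterS (FF i) => s Fs Ts; have -> : F v i s = F u i s by exact/esym/Fs.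
congr (_ + _); apply/rowP => i; rewrite !mxE.
have sub (a b : R) : `[0, T]%classic a -> `[0, T]%classic b ->
    Rintegral leb1 `[a, b] (fun s => f (Phi tau s x) (u s) ord0 i) =
    Rintegral leb1 `[a, b] (fun s => f (Phi tau s x) (v s) ord0 i).
  rewrite /= !in_itv /= => /andP[a0 aT] /andP[b0 bT].
  have abT : (`[a, b] `<=` `[0, T])%classic.
    by apply: subset_itvScc.
  have miu := measurable_int leb1 (iPhi i).
  congr fine; apply: ae_eq_integral; first exact: mD.
  - exact: measurable_funS (mD _) abT miu.
  - exact: measurable_funS (mD _) abT (mF i).
  - by apply: filterS (FF i) => s Fs /abT /Fs.
by rewrite /oriented_int; case: ifP => _; rewrite sub.
Qed.

Lemma flow_ae (u v : R -> U) :
  ae_eq leb1 `[0, T]%classic u v -> flow u = flow v.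
Proof.
move=> uv; congr xget; apply/seteqP; split => Phi /=; apply: is_flow_ae_sub => //.
exact: ae_eq_sym.
Qed.

End flow.

Section koopman.
Context {R : realType} {U : metricType R} {d : nat}.
Variables (cU : compact [set: U]) (T : R) (f : 'rV[R]_d -> U -> 'rV[R]_d).

(* By [flow_ae] the choice of representative is immaterial. *)
Definition controlled_flow (u : controls cU T) := flow f T (repr u).

Definition koopman (tau t : R) (phi : compactly_supported R d) :
    set (compactly_supported R d) :=
  [set psi | exists u : controls cU T,
     (psi : 'rV[R]_d -> R[i]) = phi \o controlled_flow u tau t].

End koopman.

(* Main.v *)
(* Sufficiency: (p, u) |-> phi o Phi^u_p is continuous from [0, T]^2 x controls
   to X, by Gronwall's lemma, and a continuous function of p and of a measurable
   function of p is measurable.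

   Necessity: with h p u := d (phi o Phi^u_p, psi_p), which is measurable in p and
   continuous in u, one must select measurably a zero of h p.  The space of
   controls is complete and separable, so a zero is the limit of a branch
   q (s 0), q (s 1), ... of points of a fixed dense sequence q, with
   d (q (s n), q (s n.+1)) <= 4^-n and h p (q (s n)) < 2^-n.  The set A n j of the
   p having an admissible branch starting from q j at level n need not be
   measurable, but has a measurable hull H n j.  Since A n j is covered by the
   A n.+1 k with k admissible after j, H n j is covered, up to a null set, by the
   corresponding H n.+1 k: off a null set, following the least admissible index
   among the H's is a measurable choice of a branch.  This replaces the projection
   theorem in the usual proof of Filippov's lemma. *)
Require Import Defs.
From HB Require Import structures.
From mathcomp Require Import all_boot all_order all_algebra.
From mathcomp Require Import generic_quotient complex.
From mathcomp Require Import all_classical all_reals all_analysis.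
From mathcomp Require Import measurable_realfun ring lra.

Set Implicit Arguments.
Unset Strict Implicit.
Unset Printing Implicit Defensive.

Import Order.TTheory GRing.Theory Num.Theory.
Import numFieldNormedType.Exports.

Local Open Scope classical_set_scope.
Local Open Scope ring_scope.

(** * Integration against the Lebesgue measure of the line *)

Section leb1_integral.
Context {R : realType}.
Local Notation mu := (@lebesgue_measure R).

(** Two obstacles shape the proof. The field is only continuous in the control, while controls are
    close only in integral distance, not pointwise. For states in a ball, uniform continuity yields
    [|f a v - f a v'| <= e + C * mdist v v'], which is affine in [mdist] and can therefore be
    integrated and fed to Gronwall's lemma. Next, [leb2] lives on the Borel sets of the plane,
    whereas [psi] is measurable only for the completion. Only countably many sublevel sets enter the
    selection, so one Borel null set absorbs all their defects, and the selection is carried out on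
    Borel sets. The rate 1 / 4 of the branches is tied to completeness: weighted by [2 ^+ n], the
    distances between successive controls still have summable integrals, which forces convergence
    almost everywhere. As [flow] is defined by choice, existence of a flow has to be proved as well;
    this is done by Picard's iteration for a truncated field. *)

Lemma measurable_lebesgueT (A : set R) :
  measurable (A : set (measurableTypeR R)) ->
  measurable (A : set (lebesgueType R)).
Proof. by move=> mA; exact: sub_caratheodory. Qed.

Lemma measurable_id_lebesgue :
  measurable_fun [set: lebesgueType R] (id : lebesgueType R -> measurableTypeR R).
Proof. by move=> _ A mA; rewrite setTI; exact: measurable_lebesgueT. Qed.

(** The identity, from Lebesgue-measurable to Borel sets, pushes [leb1] forward to the Lebesgue
    measure. This makes the fundamental theorem of calculus available for [leb1]. *)
Lemma integral_leb1E (D : set R) (g : R -> \bar R) :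
  measurable (D : set (measurableTypeR R)) ->
  measurable_fun (D : set (measurableTypeR R)) g ->
  (forall x, D x -> 0 <= g x)%E ->
  (\int[leb1]_(x in D) g x = \int[mu]_(x in D) g x)%E.
Proof.
move=> mD mg g0.
have g0' : {in D, forall y, 0 <= g y}%E by move=> x /set_mem; exact: g0.
have := @ge0_integral_pushforward _ _ _ _ R _ measurable_id_lebesgue leb1 D g mD mg g0'.
rewrite preimage_id => <-.
by apply: eq_measure_integral; [exact: measurable_id_lebesgue|move=> A mA AD].
Qed.

Lemma integral_leb1_expR (c x0 a b : R) : c != 0 -> a <= b ->
  (\int[leb1]_(s in `[a, b]) (expR (c * (s - x0)))%:E =
  ((expR (c * (b - x0)) - expR (c * (a - x0))) / c)%:E)%E.
Proof.
move=> c0 ab.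
pose F (s : R) := expR (c * (s - x0)) / c.
have dF (s : R) : is_derive s 1 F (expR (c * (s - x0))).
  apply: is_derive_eq; rewrite /GRing.scale /=.
  by rewrite !(subr0, scaler0, addr0, add0r, mulr1); field.
have cF (s : R) : {for s, continuous F} by apply/differentiable_continuous/derivable1_diffP; have [] := dF s.
have ce : continuous (fun s : R => expR (c * (s - x0))).
  move=> s; apply: continuous_comp; last exact: continuous_expR.
  by apply: cvgM; [exact: cvg_cst|apply: cvgB; [exact: cvg_id|exact: cvg_cst]].
rewrite integral_leb1E; first last.
- by move=> s _; rewrite lee_fin expR_ge0.
- apply/measurable_EFinP; apply: measurable_funTS.
  exact: continuous_measurable_fun.
- exact: measurable_itv.
move: ab; rewrite le_eqVlt => /predU1P[<-|ab].
  by rewrite subrr mul0r set_itv1 integral_set1.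
rewrite (@continuous_FTC2 _ _ F) //.
- by rewrite -EFinB /F mulrBl.
- by apply: continuous_subspaceT.
- split; first by move=> s _; have [] := dF s.
    exact/cvg_at_right_filter/cF.
  exact/cvg_at_left_filter/cF.
- by move=> s _; rewrite derive1E; have [_ ->] := dF s.
Qed.
End leb1_integral.

Section leb1_measurability.
Context {R : realType}.

Lemma continuous_measurable_leb1 (D : set R) (g : R -> R) : continuous g ->
  measurable_fun (D : set (lebesgueType R)) g.
Proof.
move=> cg; apply: measurable_funTS.
exact: (measurableT_comp (continuous_measurable_fun cg) measurable_id_lebesgue).
Qed.

Lemma bounded_integrable_leb1 (a b : R) (g : R -> R) (C : R) :
  measurable_fun (`[a, b]%classic : set (lebesgueType R)) g ->
  (forall s : R, `[a, b]%classic s -> `|g s| <= C) ->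
  leb1.-integrable `[a, b] (EFin \o g).
Proof.
move=> mg gC; apply: measurable_bounded_integrable => //.
- exact: measurable_itv_lebesgue.
- exact: leb1_itv_lty.
- exists C; split; first exact: num_real.
  by move=> M CM s /gC gsC; apply: le_trans gsC (ltW CM).
Qed.

Lemma integrable_leb1_cst (a b c : R) :
  leb1.-integrable `[a, b] (EFin \o (cst c : R -> R)).
Proof. exact: (@bounded_integrable_leb1 _ _ (cst c) `|c|). Qed.

Lemma Rintegral_leb1_cst0 (D : set R) : Rintegral leb1 D (cst 0 : R -> R) = 0.
Proof. by rewrite /Rintegral integral0_eq. Qed.

Lemma leb1_segment (a b : R) : a <= b -> leb1 `[a, b]%classic = (b - a)%:E.
Proof.
have -> : leb1 `[a, b]%classic = lebesgue_measure (`[a, b]%classic : set R) by [].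
rewrite lebesgue_measure_itv /= lte_fin le_eqVlt => /predU1P[->|->].
  by rewrite ltxx subrr.
by rewrite EFinB.
Qed.

End leb1_measurability.

Section oriented_integral.
Context {R : realType}.
Variables (T : R) (F : R -> R).
Hypothesis iF : leb1.-integrable `[0, T] (EFin \o F).
Local Notation I t := (Rintegral leb1 `[0, t] F).

Lemma subset_segment (a b : R) : `[0, T]%classic a -> `[0, T]%classic b ->
  `[a, b]%classic `<=` `[0, T]%classic.
Proof.
rewrite /= !in_itv /= => /andP[a0 _] /andP[_ bT] x /=.
by rewrite !in_itv /= => /andP[ax xb]; rewrite (le_trans a0 ax) (le_trans xb bT).
Qed.

Lemma integrable_leb1_sub (A : interval R) : [set` A] `<=` `[0, T]%classic ->
  leb1.-integrable [set` A] (EFin \o F).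
Proof. by move=> A0T; apply: integrableS iF => //; exact: measurable_itv_lebesgue. Qed.

Lemma Rintegral_leb1_set1 (a : R) : `[0, T]%classic a ->
  Rintegral leb1 [set a] F = 0.
Proof.
move=> Ta; rewrite -set_itv1 /Rintegral null_set_integral //.
- exact: measurable_itv_lebesgue.
- apply: (measurable_int leb1); apply: integrable_leb1_sub.
  by rewrite set_itv1 => _ ->.
- by have := @lebesgue_measure_set1 R a; rewrite set_itv1.
Qed.

Lemma Rintegral_leb1_split (a b : R) : 0 <= a -> a <= b -> b <= T ->
  I b = I a + Rintegral leb1 `[a, b] F.
Proof.
move=> a0 ab bT.
have T0 : `[0, T]%classic 0 by rewrite /= in_itv /= lexx (le_trans a0)// (le_trans ab).
have Ta : `[0, T]%classic a by rewrite /= in_itv /= a0 (le_trans ab).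
have Tb : `[0, T]%classic b by rewrite /= in_itv /= bT (le_trans a0).
have s1 : (`[0, b] = `[0, a] `|` `]a, b])%classic.
  by apply: itv_bndbnd_setU; rewrite bnd_simp.
have s2 : (`[a, b] = [set a] `|` `]a, b])%classic.
  by rewrite -set_itv1; apply: itv_bndbnd_setU; rewrite bnd_simp.
have mi i := @measurable_itv_lebesgue R i.
have ma : measurable ([set a] : set (lebesgueType R)) by rewrite -set_itv1.
rewrite [in RHS]s2 s1 !Rintegral_setU //.
- by rewrite Rintegral_leb1_set1 // add0r.
- by rewrite -s2; apply: integrable_leb1_sub; exact: subset_segment.
- by apply/disj_setPS => y [/= ->]; rewrite in_itv /= ltxx.
- by rewrite -s1; apply: integrable_leb1_sub; exact: subset_segment.
- apply/disj_setPS => y [/=]; rewrite !in_itv /= => /andP[_ ya].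
  by rewrite ltNge ya.
Qed.

(** Passing through the primitive from 0 settles the relative position of the end points once and
    for all: Chasles' relation becomes a cancellation. *)
Lemma oriented_intE (a b : R) : `[0, T]%classic a -> `[0, T]%classic b ->
  oriented_int a b F = I b - I a.
Proof.
rewrite /= !in_itv /= => /andP[a0 aT] /andP[b0 bT]; rewrite /oriented_int.
case: (leP a b) => [ab|/ltW ba].
  by rewrite (Rintegral_leb1_split a0 ab bT) addrC addKr.
by rewrite (Rintegral_leb1_split b0 ba aT) opprD addNKr.
Qed.

Lemma oriented_int_chasles (a b c : R) : `[0, T]%classic a ->
  `[0, T]%classic b -> `[0, T]%classic c ->
  oriented_int a b F + oriented_int b c F = oriented_int a c F.
Proof. by move=> Ta Tb Tc; rewrite !oriented_intE // addrC subrKA. Qed.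

Lemma oriented_intxx (a : R) : `[0, T]%classic a -> oriented_int a a F = 0.
Proof. by move=> Ta; rewrite oriented_intE // subrr. Qed.

(** The error [k] is integrated over all of [[0, T]], as its sign permits, so that the end points
    only affect the term in [W]. *)
Lemma normr_Rintegral_leb1_le (a b B : R) (W k : R -> R) :
  `[0, T]%classic a -> `[0, T]%classic b ->
  leb1.-integrable `[a, b] (EFin \o W) ->
  leb1.-integrable `[0, T] (EFin \o k) ->
  (forall s : R, `[0, T]%classic s -> 0 <= k s) ->
  (forall s : R, `[a, b]%classic s -> `|F s| <= B * W s + k s) ->
  `|Rintegral leb1 `[a, b] F| <=
    B * Rintegral leb1 `[a, b] W + Rintegral leb1 `[0, T] k.
Proof.
move=> Ta Tb iW ik k0 FWk.
have mi i := @measurable_itv_lebesgue R i.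
have sub := subset_segment Ta Tb.
have iFab := integrable_leb1_sub sub.
have ikab : leb1.-integrable `[a, b] (EFin \o k) by apply: integrableS ik.
apply: le_trans (le_normr_Rintegral _ iFab) _; first exact: mi.
have iBW : leb1.-integrable `[a, b] (EFin \o (fun s => B * W s)).
  by have := integrableZl (mi _) B iW.
apply: (@le_trans _ _ (Rintegral leb1 `[a, b] (fun s => B * W s + k s))).
  apply: le_Rintegral => //; first by have := integrable_abse iFab.
  by have := integrableD (mi _) iBW ikab.
rewrite RintegralD // RintegralZl // lerD2l.
rewrite /Rintegral fine_le //; try exact: integrable_fin_num.
by apply: ge0_subset_integral => //; exact: measurable_int ik.
Qed.

(* With lam large, integration against the weight [expR (lam * `|s - tau|)] gains
   the factor 1 / lam: this is what makes Picard's operator a contraction and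
   what closes Gronwall's argument. *)
Lemma normr_oriented_int_le (tau t lam B : R) (k : R -> R) :
  `[0, T]%classic tau -> `[0, T]%classic t -> 0 < lam -> 0 <= B ->
  leb1.-integrable `[0, T] (EFin \o k) ->
  (forall s : R, `[0, T]%classic s -> 0 <= k s) ->
  (forall s : R, `[0, T]%classic s ->
    `|F s| <= B * expR (lam * `|s - tau|) + k s) ->
  `|oriented_int tau t F| <=
    B / lam * expR (lam * `|t - tau|) + Rintegral leb1 `[0, T] k.
Proof.
move=> Ttau Tt lam0 B0 ik k0 FB.
(* One computation serves both directions of time: with [x0 = tau], take [c = lam] after [tau] and
   [c = - lam] before it. The value 1 of the weight at [tau] is subtracted by the integral and is
   then dropped. *)
have key (a b c x0 : R) : c != 0 -> a <= b ->
    `[0, T]%classic a -> `[0, T]%classic b ->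
    (forall s : R, `[a, b]%classic s -> c * (s - x0) = lam * `|s - tau|) ->
    `|Rintegral leb1 `[a, b] F| <=
    B * ((expR (c * (b - x0)) - expR (c * (a - x0))) / c) + Rintegral leb1 `[0, T] k.
  move=> c0 ab Ta Tb cE.
  have := integral_leb1_expR x0 c0 ab => E.
  have -> : (expR (c * (b - x0)) - expR (c * (a - x0))) / c =
    Rintegral leb1 `[a, b] (fun s => expR (c * (s - x0))) by rewrite /Rintegral E.
  apply: normr_Rintegral_leb1_le => //.
    apply/integrableP; split.
      apply/measurable_EFinP; apply: continuous_measurable_leb1 => s.
      apply: continuous_comp; last exact: continuous_expR.
      by apply: cvgM; [exact: cvg_cst|apply: cvgB; [exact: cvg_id|exact: cvg_cst]].
    under eq_integral do rewrite /= ger0_norm ?expR_ge0 //.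
    by rewrite E ltry.
  by move=> s abs; rewrite cE //; apply: FB; exact: (subset_segment Ta Tb).
rewrite /oriented_int; case: ifPn => [taut|]; last rewrite -ltNge => /ltW ttau.
  apply: le_trans (key tau t lam tau _ _ _ _ _) _ => //; first by rewrite gt_eqF.
    by move=> s /=; rewrite in_itv /= => /andP[ts _]; rewrite ger0_norm // subr_ge0.
  rewrite lerD2r -mulrA ler_wpM2l // mulrC.
  rewrite ler_wpM2l ?invr_ge0 ?(ltW lam0) // subrr mulr0 expR0.
  by rewrite (ger0_norm (_ : 0 <= t - tau)) ?subr_ge0 // lerBlDr lerDl ler01.
rewrite normrN; apply: le_trans (key t tau (- lam) tau _ _ _ _ _) _ => //.
- by rewrite oppr_eq0 gt_eqF.
- move=> s /=; rewrite in_itv /= => /andP[_ st].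
  by rewrite ler0_norm ?subr_le0 // mulrN mulNr.
rewrite lerD2r -mulrA ler_wpM2l // subrr mulr0 expR0 invrN mulrN -mulNr opprB.
rewrite mulrC ler_wpM2l ?invr_ge0 ?(ltW lam0) //.
by rewrite ler0_norm ?subr_le0 // mulrN mulNr lerBlDr lerDl ler01.
Qed.

Lemma oriented_int_lipschitz (a b C : R) :
  `[0, T]%classic a -> `[0, T]%classic b ->
  (forall s : R, `[0, T]%classic s -> `|F s| <= C) ->
  `|oriented_int a b F| <= C * `|b - a|.
Proof.
move=> Ta Tb FC.
have key (x y : R) : x <= y -> `[0, T]%classic x -> `[0, T]%classic y ->
    `|Rintegral leb1 `[x, y] F| <= C * (y - x).
  move=> xy Tx Ty.
  have mi i := @measurable_itv_lebesgue R i.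
  apply: le_trans (@normr_Rintegral_leb1_le x y C (cst 1) (cst 0) Tx Ty
    (integrable_leb1_cst _ _ _) (integrable_leb1_cst _ _ _) _ _) _ => //.
    by move=> s /(subset_segment Tx Ty) /FC; rewrite mulr1 addr0.
  by rewrite Rintegral_leb1_cst0 Rintegral_cst // leb1_segment //= addr0 mul1r.
rewrite /oriented_int; case: ifPn => [ab|]; last rewrite -ltNge => /ltW ba.
  by rewrite (ger0_norm (_ : 0 <= b - a)) ?subr_ge0 //; exact: key.
by rewrite normrN (ler0_norm (_ : b - a <= 0)) ?subr_le0 // opprB; exact: key.
Qed.
End oriented_integral.

(** * Topological facts *)

Section topology_facts.

(** The base consists of interiors of balls, since balls of a [pseudoMetricType] need not be open. A
    dense point within half the radius of [x] guarantees that [x] lies in the interior. *)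
Lemma second_countable_dense {R : realType} (X : pseudoMetricType R)
    (I : countType) (q : I -> X) :
  (forall x e, 0 < e -> exists i, ball x e (q i)) -> @second_countable X.
Proof.
move=> dq; pose b (p : I * nat) := (ball (q p.1) p.2.+1%:R^-1)°.
exists (range b); first by apply: sub_countable (card_image_le _ _) _; exact: countableP.
split; first by move=> _ [p _ <-]; exact: open_interior.
move=> x V /nbhs_ballP[e /= e0 xeV].
have [n _ ne] := near_infty_natSinv_lt (PosNum (divr_gt0 e0 (ltr0n _ 2))).
have {}ne := ne n (leqnn n); rewrite /= in ne.
have n2 : 0 < n.+1%:R^-1 / 2 :> R by rewrite divr_gt0.
have [i qi] := dq x _ n2.
have ix : b (i, n) x.
  rewrite /b /interior /=; apply/nbhs_ballP; exists (n.+1%:R^-1 / 2) => //= y xy.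
  by rewrite [X in ball _ X](splitr); apply: ball_triangle xy; exact: ball_sym.
exists (b (i, n)); first by split => //; exists (i, n).
apply: subset_trans xeV => y /interior_subset /= qy.
apply: (@le_ball _ _ _ (n.+1%:R^-1 + n.+1%:R^-1)).
  by rewrite [leRHS]splitr lerD // ltW.
by apply: ball_triangle qy; apply: ball_sym; exact: interior_subset ix.
Qed.

(** To each basic [A] is attached the largest open set whose product with [A] lies in [W];
    countability thus comes from the first factor alone. *)
Lemma open_second_countableX (X Y : topologicalType) (W : set (X * Y)) :
  @second_countable X -> open W ->
  exists B : set (set X), exists V : set X -> set Y,
    [/\ countable B, forall A, B A -> open A, forall A, open (V A) &
        W = \bigcup_(A in B) (A `*` V A)].
Proof.
move=> [B cB [oB bB]] oW.
exists B, (fun A => [set y | forall x, A x -> W (x, y)]°).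
split => //; first by move=> A; exact: open_interior.
apply/seteqP; split => [[x y] Wxy|[x y] /= [A BA [/= Ax /interior_subset]]]; last exact.
have := open_nbhs_nbhs (conj oW Wxy) => -[[P Q] /= [xP yQ] PQW].
have [A [BA Ax] AP] := bB x P xP.
exists A => //; split => //=; apply: filterS yQ => z Qz x' /AP Px'.
exact: (PQW (x', z)).
Qed.

(* Only one of the two factors has to be second countable; no structure is needed
   on the family M besides the closure properties, so that it can be a completed
   sigma-algebra. *)
Lemma preimage_pair_second_countable (O : Type) (M : set (set O))
    (X Y Z : topologicalType) (D : set O) (a : O -> X) (b : O -> Y) (g : X * Y -> Z) :
  M set0 -> setI_closed M ->
  (forall F : nat -> set O, (forall n, M (F n)) -> M (\bigcup_n F n)) ->
  @second_countable X -> continuous g ->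
  (forall V, open V -> M (D `&` a @^-1` V)) ->
  (forall V, open V -> M (D `&` b @^-1` V)) ->
  forall V, open V -> M (D `&` (fun w => g (a w, b w)) @^-1` V).
Proof.
move=> M0 MI MU scX cg ma mb V oV.
have oW : open (g @^-1` V) by move/continuousP : cg; apply.
have [B [W [cB oB oW' gE]]] := open_second_countableX scX oW.
have -> : D `&` (fun w => g (a w, b w)) @^-1` V =
    \bigcup_(A in B) ((D `&` a @^-1` A) `&` (D `&` b @^-1` W A)).
  apply/seteqP; split => w /=.
    move=> [Dw gV]; have : (g @^-1` V) (a w, b w) by [].
    by rewrite gE => -[A BA [/= Aa Wb]]; exists A.
  move=> [A BA [[Dw Aa] [_ Wb]]]; split => //.
  suff : (g @^-1` V) (a w, b w) by [].
  by rewrite gE; exists A.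
(* [M] is closed under unions of sequences: the union over [B] is re-indexed by the injection [f],
   and an integer outside its range contributes [set0]. *)
have [f finj] := countable_injP _ cB.
have -> : \bigcup_(A in B) ((D `&` a @^-1` A) `&` (D `&` b @^-1` W A)) =
   \bigcup_n \bigcup_(A in B `&` [set A | f A = n]) ((D `&` a @^-1` A) `&` (D `&` b @^-1` W A)).
  apply/seteqP; split => [w [A BA Aw]|w [n _ [A [BA _] Aw]]]; last by exists A.
  by exists (f A) => //; exists A.
apply: MU => n.
have [[A [BA fA]]|nA] := pselect (exists A, B A /\ f A = n).
  rewrite (_ : B `&` _ = [set A]) ?bigcup_set1.
    by apply: MI; [exact: ma (oB A BA)|exact: mb].
  apply/seteqP; split => [A' [/= BA' fA']|_ ->] //.
  by apply: finj; rewrite ?inE // fA'.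
rewrite (_ : B `&` _ = set0) ?bigcup_set0 //.
by apply/seteqP; split => // A [/= BA fA]; apply: nA; exists A.
Qed.

(** The radius plays the role of the parameter, tending to 0 from the right, in the near-covering
    form of compactness. The point [y] may leave [A], which allows [A] to be as thin as a
    diagonal. *)
Lemma compact_unif_continuous {R : realType} (X Y : pseudoMetricType R)
    (A : set X) (g : X -> Y) (e : R) :
  compact A -> {in A, continuous g} -> 0 < e ->
  exists2 r : R, 0 < r & forall x y, A x -> ball x r y -> ball (g x) e (g y).
Proof.
move=> /compact_near_coveringP cA cg e0.
have := cA _ (0^'+ : set_system R) (fun r x => forall y, ball x r y -> ball (g x) e (g y)).
move=> /(_ _) [].
  move=> x Ax.
  have e2 : 0 < e / 2 by rewrite divr_gt0.
  have /nbhs_ballP[r /= r0 rV] := cg x (mem_set Ax) _ (nbhsx_ballx _ _ e2).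
  exists (ball x (r / 2), [set s | s < r / 2]).
    split => /=; first by apply: nbhsx_ballx; rewrite divr_gt0.
    by apply: nbhs_right_lt; rewrite divr_gt0.
  move=> [x' s] /= [xx' sr] y x'y.
  rewrite [e]splitr; apply: (@ball_triangle _ _ (g x)).
    apply: ball_sym; apply: rV; apply: le_ball xx'.
    by rewrite ler_pdivrMr // ler_peMr ?ltW // ltr1n.
  apply: rV; rewrite [r]splitr; apply: ball_triangle xx' _.
  by apply: le_ball x'y; exact: ltW.
move=> r /= r0 hr; exists (r / 2); first by rewrite divr_gt0.
have r2 : 0 < r / 2 by rewrite divr_gt0.
move=> x y Ax xy; apply: (hr (r / 2)) => //=.
by rewrite sub0r normrN gtr0_norm // ltr_pdivrMr // ltr_pMr // ltr1n.
Qed.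

End topology_facts.

Lemma ball_ratr {R : realType} (x e : R) : 0 < e -> exists r : rat, ball x e (ratr r).
Proof.
move=> e0; have [|r] := @rat_in_itvoo R (x - e) (x + e); first by rewrite ltrD2l gtrN.
rewrite in_itv /= => /andP[q1 q2]; exists r.
by rewrite -ball_normE /= ltr_distlC q1.
Qed.

(** * Row vectors with the maximum norm *)

Section rV_norm.
Context {R : realType} {d : nat}.
Implicit Types x y : 'rV[R]_d.

Lemma rV_norm_le x (c : R) : 0 <= c ->
  (forall i, `|x ord0 i| <= c) -> `|x| <= c.
Proof.
move=> c0 xc; rewrite /Num.Def.normr /= mx_normrE; apply/bigmax_leP; split => // -[i j] _.
by rewrite ord1.
Qed.

Lemma rV_coord_le x i : `|x ord0 i| <= `|x|.
Proof.
by rewrite [leRHS]/Num.Def.normr /= mx_normrE; apply/bigmax_geP; right => /=; exists (ord0, i).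
Qed.

Lemma rV_ball_compact (rho : R) : compact [set x : 'rV[R]_d | `|x| <= rho].
Proof.
apply: bounded_closed_compact.
  exists rho; split; first exact: num_real.
  by move=> M rM a /= /le_trans; apply; exact: ltW.
apply: (closed_comp (f := fun a : 'rV[R]_d => `|a|) (D := [set r | r <= rho])).
  by move=> a _; exact: norm_continuous.
exact: closed_le.
Qed.

(** The hypotheses on [f] are Euclidean, while the norm of ['rV[R]_d] is the maximum of the
    coordinates, for which integrals are estimated coordinate by coordinate at no cost. This bound
    and the next one translate between the two. *)
Lemma rV_norm_enorm x : `|x| <= enorm x.
Proof.
apply: rV_norm_le => [|i]; first exact: sqrtr_ge0.
rewrite -sqrtr_sqr /enorm ler_wsqrtr // (bigD1 i) //= lerDl.
by apply: sumr_ge0 => j _; exact: sqr_ge0.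
Qed.

Lemma enorm_rV_norm x : enorm x <= Num.sqrt d%:R * `|x|.
Proof.
rewrite -[X in _ * X]ger0_norm // -sqrtr_sqr -sqrtrM // /enorm ler_wsqrtr //.
apply: (@le_trans _ _ (\sum_(i < d) `|x| ^+ 2)).
  by apply: ler_sum => i _; rewrite -real_normK ?num_real // lerXn2r ?nnegrE // rV_coord_le.
by rewrite sumr_const card_ord mulr_natl.
Qed.

Lemma rV_second_countable : @second_countable 'rV[R]_d.
Proof.
apply: (@second_countable_dense _ _ 'rV[rat]_d (map_mx (@ratr R))) => x e e0.
have e2 : 0 < e / 2 by rewrite divr_gt0.
have [q hq] := choice (fun i => ball_ratr (x ord0 i) e2).
exists (\row_i q i); rewrite -ball_normE /=.
apply: (@le_lt_trans _ _ (e / 2)); last by rewrite ltr_pdivrMr // ltr_pMr // ltr1n.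
apply: rV_norm_le => [|i]; first exact: ltW.
by have := hq i; rewrite -ball_normE /= !mxE => /ltW.
Qed.

End rV_norm.

(** * Gronwall's lemma *)

Section gronwall.
Context {R : realType}.

Lemma geometric_small (K e : R) : 0 < e -> exists n, K / 2 ^+ n < e.
Proof.
move=> e0; have : (fun n => geometric K (2^-1) n) @ \oo --> (0 : R).
  by apply: cvg_geometric; rewrite gtr0_norm ?invf_lt1 // ltr1n.
move=> /cvgr_lt /(_ _ e0) [n _ /(_ n (leqnn n))] /= ltn.
by exists n; rewrite -exprVn.
Qed.

Lemma le_geometric (a b K : R) : (forall n, a <= b + K / 2 ^+ n) -> a <= b.
Proof.
move=> abK; apply/ler_addgt0Pr => e e0; have [n ltn] := geometric_small K e0.
by apply: le_trans (abK n) _; rewrite lerD2l ltW.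
Qed.

(* The integral inequality is replaced by the self-improvement of any bound on
   g / w, so that g need not be measurable. *)
Lemma gronwall (S : set R) (w g : R -> R) (a : R) :
  (forall s, S s -> 1 <= w s) -> 0 <= a ->
  (exists M, forall s, S s -> g s <= M * w s) ->
  (forall M, 0 <= M -> (forall s, S s -> g s <= M * w s) ->
     forall t, S t -> g t <= a + M / 2 * w t) ->
  forall t, S t -> g t <= 2 * a * w t.
Proof.
move=> w1 a0 [M0 gM0] step t St.
pose M := Num.max M0 0.
have M_ge0 : 0 <= M by rewrite le_max lexx orbT.
(* [2 * a] is the fixed point of the map sending [B] to [a + B / 2]; each use of [step] halves the
   distance to it, the constant [a] being absorbed by [a * w s] because [w] is at least 1. *)
have gM n : forall s, S s -> g s <= (2 * a + M / 2 ^+ n) * w s.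
  elim: n => [s Ss|n IH s Ss].
    rewrite expr0 divr1; apply: le_trans (gM0 s Ss) _.
    rewrite ler_wpM2r ?(le_trans ler01 (w1 s Ss)) //.
    by rewrite (@le_trans _ _ M) ?le_max ?lexx // lerDr mulr_ge0.
  have /step/(_ IH s Ss) : 0 <= 2 * a + M / 2 ^+ n.
    by rewrite addr_ge0 ?mulr_ge0 ?invr_ge0 ?exprn_ge0.
  move=> /le_trans; apply.
  rewrite exprS invfM; have := ler_wpM2l a0 (w1 s Ss); rewrite mulr1.
  set p := M / 2 ^+ n.
  have -> : M * (2^-1 / 2 ^+ n) = p / 2 by rewrite /p; field; rewrite expf_neq0.
  by move=> ?; lra.
apply: (@le_geometric _ _ (M * w t)) => n.
by rewrite (mulrAC M) -mulrDl; exact: gM.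
Qed.

End gronwall.

(** * Carathéodory differential equations *)

Section vector_integral.
Context {R : realType} {d : nat}.
Variable T : R.
Implicit Types g h : R -> 'rV[R]_d.

Definition vintegrable g :=
  forall i, leb1.-integrable `[0, T] (EFin \o (fun s => g s ord0 i)).

Definition vint (tau t : R) g : 'rV[R]_d :=
  \row_i oriented_int tau t (fun s => g s ord0 i).

Lemma vint_chasles g a b c : vintegrable g ->
  `[0, T]%classic a -> `[0, T]%classic b -> `[0, T]%classic c ->
  vint a b g + vint b c g = vint a c g.
Proof.
by move=> ig Ta Tb Tc; apply/rowP => i; rewrite !mxE (oriented_int_chasles (ig i)).
Qed.

Lemma vintxx g a : vintegrable g -> `[0, T]%classic a -> vint a a g = 0.
Proof. by move=> ig Ta; apply/rowP => i; rewrite !mxE (oriented_intxx (ig i)). Qed.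

Lemma vintegrableB g h : vintegrable g -> vintegrable h ->
  vintegrable (fun s => g s - h s).
Proof.
move=> ig ih i; have := integrableB (measurable_itv_lebesgue _) (ig i) (ih i).
by apply: eq_integrable => [|s _ /=]; [exact: measurable_itv_lebesgue|rewrite !mxE].
Qed.

Lemma vintB g h a b : vintegrable g -> vintegrable h ->
  `[0, T]%classic a -> `[0, T]%classic b ->
  vint a b (fun s => g s - h s) = vint a b g - vint a b h.
Proof.
move=> ig ih Ta Tb; apply/rowP => i; rewrite !mxE.
have E t : `[0, T]%classic t ->
    Rintegral leb1 `[0, t] (fun s => (g s - h s) ord0 i) =
    Rintegral leb1 `[0, t] (fun s => g s ord0 i) -
    Rintegral leb1 `[0, t] (fun s => h s ord0 i).
  move=> Tt; have T0 : `[0, T]%classic 0.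
    by move: Tt; rewrite /= !in_itv /= lexx => /andP[]; exact: le_trans.
  rewrite -RintegralB; first last.
  - by apply: (integrable_leb1_sub (ih i)); exact: subset_segment.
  - by apply: (integrable_leb1_sub (ig i)); exact: subset_segment.
  - exact: measurable_itv_lebesgue.
  by apply: eq_Rintegral => s _; rewrite !mxE.
rewrite (oriented_intE (vintegrableB ig ih i)) // (oriented_intE (ig i)) //.
by rewrite (oriented_intE (ih i)) // !E //; ring.
Qed.

Lemma vint_norm_le g (tau t lam B : R) (k : R -> R) :
  vintegrable g ->
  `[0, T]%classic tau -> `[0, T]%classic t -> 0 < lam -> 0 <= B ->
  leb1.-integrable `[0, T] (EFin \o k) ->
  (forall s : R, `[0, T]%classic s -> 0 <= k s) ->
  (forall s : R, `[0, T]%classic s ->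
    `|g s| <= B * expR (lam * `|s - tau|) + k s) ->
  `|vint tau t g| <=
    B / lam * expR (lam * `|t - tau|) + Rintegral leb1 `[0, T] k.
Proof.
move=> ig Ttau Tt lam0 B0 ik k0 gk; apply: rV_norm_le => [|i].
  apply: addr_ge0; first by rewrite mulr_ge0 ?expR_ge0 // divr_ge0 // ltW.
  by apply: Rintegral_ge0 => s; exact: k0.
rewrite mxE; apply: (normr_oriented_int_le (ig i)) => // s Ts.
by apply: le_trans (rV_coord_le _ _) _; exact: gk.
Qed.

Lemma vint_lipschitz g (a b C : R) : vintegrable g ->
  `[0, T]%classic a -> `[0, T]%classic b ->
  (forall s : R, `[0, T]%classic s -> `|g s| <= C) ->
  `|vint a b g| <= C * `|b - a|.
Proof.
move=> ig Ta Tb gC; apply: rV_norm_le => [|i].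
  by rewrite mulr_ge0 // (le_trans _ (gC a Ta)).
rewrite mxE; apply: (oriented_int_lipschitz (ig i)) => // s Ts.
by apply: le_trans (rV_coord_le _ _) _; exact: gC.
Qed.

(** Integrability alone gives the a priori bound on trajectories from which Gronwall's iteration
    starts. *)
Lemma vint_bounded g : vintegrable g ->
  exists M, forall a b, `[0, T]%classic a -> `[0, T]%classic b -> `|vint a b g| <= M.
Proof.
move=> ig.
pose J i := Rintegral leb1 `[0, T] (fun s => `|g s ord0 i|).
have J0 i : 0 <= J i by apply: Rintegral_ge0.
have ia i : leb1.-integrable `[0, T] (EFin \o (fun s => `|g s ord0 i|)).
  by have := integrable_abse (ig i).
exists (\sum_i (J i + J i)) => a b Ta Tb.
apply: rV_norm_le => [|i]; first by apply: sumr_ge0 => i _; exact: addr_ge0.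
have Jt t : `[0, T]%classic t -> `|Rintegral leb1 `[0, t] (fun s => g s ord0 i)| <= J i.
  move=> Tt; have T0 : `[0, T]%classic 0.
    by move: Tt; rewrite /= !in_itv /= lexx => /andP[]; exact: le_trans.
  have := @normr_Rintegral_leb1_le _ T _ (ig i) 0 t 0 (cst 0) _ T0 Tt _ (ia i)
    (fun _ _ => normr_ge0 _).
  rewrite mul0r add0r; apply.
    exact: integrable_leb1_cst.
  by move=> s _; rewrite mul0r add0r.
rewrite mxE (oriented_intE (ig i)) //.
apply: le_trans (ler_normB _ _) _; apply: le_trans (lerD (Jt b Tb) (Jt a Ta)) _.
rewrite (bigD1 i) //= lerDl; apply: sumr_ge0 => j _; exact: addr_ge0.
Qed.

End vector_integral.

(** * A priori bounds and comparison of trajectories *)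

Section solutions.
Context {R : realType} {U : metricType R} {d : nat}.
Variable T : R.
Implicit Types (F : 'rV[R]_d -> U -> 'rV[R]_d) (y : R -> 'rV[R]_d).

Definition solves F (u : R -> U) (tau : R) (x : 'rV[R]_d) y :=
  vintegrable T (fun s => F (y s) (u s)) /\
  forall t, `[0, T]%classic t ->
    y t = x + vint tau t (fun s => F (y s) (u s)).

Lemma solves_start F u tau x y : `[0, T]%classic tau ->
  solves F u tau x y -> y tau = x.
Proof. by move=> Ttau [iy yE]; rewrite yE // (vintxx iy) // addr0. Qed.

(** By Chasles' relation the initial time slides along a trajectory. This stands in for the
    composition law of flows: it allows initial times to be compared and bounds to be carried
    backward in time. *)
Lemma solves_restart F u tau tau' x y :
  `[0, T]%classic tau -> `[0, T]%classic tau' ->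
  solves F u tau x y -> solves F u tau' (y tau') y.
Proof.
move=> Ttau Ttau' [iy yE]; split => // t Tt.
by rewrite yE // (yE tau') // -addrA (vint_chasles iy).
Qed.

Lemma solves_bounded F u tau x y : `[0, T]%classic tau ->
  solves F u tau x y -> exists M, forall t, `[0, T]%classic t -> `|y t| <= M.
Proof.
move=> Ttau [iy yE]; have [M hM] := vint_bounded iy.
exists (`|x| + M) => t Tt; rewrite yE //.
by apply: le_trans (ler_normD _ _) _; rewrite lerD2l hM.
Qed.

Lemma one_le_weight (lam : R) (s tau : R) : 0 < lam -> 1 <= expR (lam * `|s - tau|).
Proof. by move=> lam0; rewrite -expR0 ler_expR mulr_ge0 // ltW. Qed.

Lemma weight_le (lam : R) (s tau : R) : 0 < lam ->
  `[0, T]%classic s -> `[0, T]%classic tau ->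
  expR (lam * `|s - tau|) <= expR (lam * T).
Proof.
move=> lam0; rewrite /= !in_itv /= => /andP[s0 sT] /andP[t0 tT].
rewrite ler_expR ler_wpM2l ?(ltW lam0) // ler_norml.
by apply/andP; split; lra.
Qed.

(** Gronwall's lemma with a weight of rate [2 * m]: the growth bound costs a factor [m], integration
    gains [2 * m], and the quotient is the 1 / 2 that [gronwall] asks for. The rates [2 * l] below
    arise in the same way. *)
Lemma solves_growth F u tau x y (m : R) : `[0, T]%classic tau -> 0 < m ->
  (forall z v, `|F z v| <= m * (1 + `|z|)) -> solves F u tau x y ->
  forall t, `[0, T]%classic t ->
    1 + `|y t| <= 2 * (1 + `|x|) * expR (2 * m * T).
Proof.
move=> Ttau m0 Fm sy t Tt.
have [M0 yM0] := solves_bounded Ttau sy.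
have m20 : 0 < 2 * m by rewrite mulr_gt0.
apply: (@le_trans _ _ (2 * (1 + `|x|) * expR (2 * m * `|t - tau|))); last first.
  by rewrite ler_wpM2l ?mulr_ge0 ?addr_ge0 // weight_le.
apply: (@gronwall _ `[0, T]%classic (fun s => expR (2 * m * `|s - tau|))
  (fun s => 1 + `|y s|) (1 + `|x|)) => //.
- by move=> s _; exact: one_le_weight.
- exists (1 + M0) => s Ts; apply: (@le_trans _ _ (1 + M0)); first by rewrite lerD2l yM0.
  by rewrite ler_peMr ?one_le_weight // addr_ge0 // (le_trans _ (yM0 s Ts)).
move=> M M_ge0 yM r Tr; have [iy yE] := sy.
rewrite yE // -addrA lerD2l; apply: le_trans (ler_normD _ _) _; rewrite lerD2l.
have := @vint_norm_le _ _ T (fun s => F (y s) (u s)) tau r (2 * m) (m * M) (cst 0) iy Ttau Tr m20.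
rewrite Rintegral_leb1_cst0.
have -> : m * M / (2 * m) = M / 2 by field; rewrite gt_eqF.
rewrite addr0; apply => //; first by rewrite mulr_ge0 // ltW.
  exact: integrable_leb1_cst.
move=> s Ts; rewrite addr0; apply: le_trans (Fm _ _) _.
by rewrite -mulrA ler_wpM2l ?(ltW m0) // yM.
Qed.

Lemma control_mdist_integrable (u v : control U T) :
  compact [set: U] ->
  leb1.-integrable `[0, T] (EFin \o (fun s : R => mdist (u s) (v s))).
Proof.
move=> cU; apply/integrableP; split; first by apply/measurable_EFinP; exact: measurable_mdist.
under eq_integral do rewrite /= ger0_norm ?mdist_ge0 //.
have := integral_mdist_fin cU u v; rewrite ge0_fin_numE //.
by apply: integral_ge0 => s _; rewrite lee_fin mdist_ge0.
Qed.

(** The difference of the right-hand sides splits into a change of state, handled by the Lipschitz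
    constant, and a change of control, handled by the error [k]. Only the integral of [k] survives,
    hence the integral distance between the controls. *)
Lemma solves_compare F (u u' : control U T) tau x x' y y' (rho l e C : R) :
  compact [set: U] -> `[0, T]%classic tau -> 0 < l -> 0 <= e -> 0 <= C ->
  (forall a b v, `|a| <= rho -> `|b| <= rho -> `|F a v - F b v| <= l * `|a - b|) ->
  (forall a v v', `|a| <= rho -> `|F a v - F a v'| <= e + C * mdist v v') ->
  solves F u tau x y -> solves F u' tau x' y' ->
  (forall t, `[0, T]%classic t -> `|y t| <= rho) ->
  (forall t, `[0, T]%classic t -> `|y' t| <= rho) ->
  forall t, `[0, T]%classic t -> `|y t - y' t| <=
   2 * (`|x - x'| + (e * T + C * Rintegral leb1 `[0, T] (fun s => mdist (u s) (u' s))))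
   * expR (2 * l * T).
Proof.
move=> cU Ttau l0 e0 C0 Fl FC [iy yE] [iy' y'E] yrho y'rho t Tt.
have l20 : 0 < 2 * l by rewrite mulr_gt0.
pose k (s : R) := e + C * mdist (u s) (u' s).
have mi := @measurable_itv_lebesgue R `[0, T].
have ie := @integrable_leb1_cst R 0 T e.
have im := control_mdist_integrable u u' cU.
have iCm : leb1.-integrable `[0, T] (EFin \o (fun s : R => C * mdist (u s) (u' s))).
  by have := integrableZl mi C im.
have ik : leb1.-integrable `[0, T] (EFin \o k) by have := integrableD mi ie iCm.
have k0 s : 0 <= k s by rewrite addr_ge0 // mulr_ge0 // mdist_ge0.
have kE : Rintegral leb1 `[0, T] k =
    e * T + C * Rintegral leb1 `[0, T] (fun s => mdist (u s) (u' s)).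
  rewrite /k RintegralD // RintegralZl // Rintegral_cst //; congr (e * _ + _).
  rewrite leb1_segment /= ?subr0 //.
  by move: Ttau; rewrite /= in_itv /= => /andP[]; exact: le_trans.
rewrite -kE; set c := Rintegral _ _ _.
have c0 : 0 <= c by apply: Rintegral_ge0 => s _; exact: k0.
apply: (@le_trans _ _ (2 * (`|x - x'| + c) * expR (2 * l * `|t - tau|))); last first.
  by rewrite ler_wpM2l ?mulr_ge0 ?addr_ge0 // weight_le.
apply: (@gronwall _ `[0, T]%classic (fun s => expR (2 * l * `|s - tau|))
  (fun s => `|y s - y' s|) (`|x - x'| + c)) => //.
- by move=> s _; exact: one_le_weight.
- by rewrite addr_ge0.
- exists (rho + rho) => s Ts; apply: (@le_trans _ _ (rho + rho)).
    by apply: le_trans (ler_normB _ _) _; rewrite lerD ?yrho ?y'rho.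
  by rewrite ler_peMr ?one_le_weight // addr_ge0 // (le_trans _ (yrho s Ts)).
move=> M M_ge0 yM r Tr.
rewrite yE // y'E // opprD addrACA; apply: le_trans (ler_normD _ _) _.
rewrite -(vintB iy iy') // -addrA lerD2l addrC.
have -> : M / 2 = l * M / (2 * l) by field; rewrite gt_eqF.
apply: vint_norm_le => //; first exact: vintegrableB.
  by rewrite mulr_ge0 // ltW.
move=> s Ts.
rewrite (_ : F (y s) (u s) - F (y' s) (u' s) =
  (F (y s) (u s) - F (y' s) (u s)) + (F (y' s) (u s) - F (y' s) (u' s))); last first.
  by rewrite addrA subrK.
apply: le_trans (ler_normD _ _) _; apply: lerD; last by apply: FC; exact: y'rho.
apply: le_trans (Fl _ _ _ (yrho s Ts) (y'rho s Ts)) _.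
by rewrite -mulrA ler_wpM2l ?(ltW l0) // yM.
Qed.

End solutions.

Section geometric.
Context {R : realType}.

Lemma geometric_ball (X : pseudoMetricType R) (a : nat -> X) (K : R) n k :
  0 < K -> (forall n, ball (a n) (K / 2 ^+ n) (a n.+1)) ->
  ball (a n) (2 * K / 2 ^+ n) (a (n + k)%N).
Proof.
move=> K0 aK; elim: k n => [|k IH] n.
  by rewrite addn0; apply: ballxx; rewrite divr_gt0 ?exprn_gt0 // mulr_gt0.
rewrite addnS -addSn; have := ball_triangle (aK n) (IH n.+1).
have -> // : K / 2 ^+ n + 2 * K / 2 ^+ n.+1 = 2 * K / 2 ^+ n.
by rewrite exprS; field; rewrite expf_neq0.
Qed.

Lemma geometric_cauchy (X : pseudoMetricType R) (a : nat -> X) (K : R) :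
  0 < K -> (forall n, ball (a n) (K / 2 ^+ n) (a n.+1)) -> cauchy (a @ \oo).
Proof.
move=> K0 aK; apply: cauchy_exP => e e0.
have [n ltn] := geometric_small (2 * K) e0.
exists (a n); exists n => // m /= nm; rewrite -(subnKC nm).
by apply: le_ball (geometric_ball n (m - n) K0 aK); exact: ltW.
Qed.

End geometric.

(** * Picard's iteration for a bounded and globally Lipschitz field *)

Section picard.
Context {R : realType} {U : metricType R} {d : nat}.
Variables (T : R) (F : 'rV[R]_d -> U -> 'rV[R]_d).
Hypothesis T0 : 0 <= T.
Hypothesis Fcont : continuous (uncurry F).

Lemma lipschitz_continuous_rV (C : R) (y : R -> 'rV[R]_d) :
  (forall t t', `|y t - y t'| <= C * `|t - t'|) -> continuous y.
Proof.
move=> yC t; apply/cvgrPdist_le => e e0.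
have C0 : 0 < `|C| + 1 by rewrite ltr_wpDl.
near=> s; apply: le_trans (yC _ _) _.
apply: (@le_trans _ _ ((`|C| + 1) * `|t - s|)).
  by rewrite ler_wpM2r // (le_trans (ler_norm C)) // lerDl.
rewrite -ler_pdivlMl // mulrC; near: s.
by apply: cvgr_dist_le => //; rewrite divr_gt0.
Unshelve. all: by end_near. Qed.

(** The state is continuous and the control merely Lebesgue measurable; the countable base of the
    state space makes the pair compose measurably with the jointly continuous [F]. *)
Lemma measurable_rhs (u : control U T) (y : R -> 'rV[R]_d) i : continuous y ->
  measurable_fun (`[0, T]%classic : set (lebesgueType R)) (fun s => F (y s) (u s) ord0 i).
Proof.
move=> cy; apply: (measurability _ (RGenInftyO.measurableE R)) => _ [_ [r ->] <-].
have cF : continuous (fun p : 'rV[R]_d * U => uncurry F p ord0 i).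
  move=> p; apply: (@continuous_comp _ _ _ (uncurry F) (fun M : 'rV[R]_d => M ord0 i)).
    exact: Fcont.
  exact: coord_continuous.
have := @preimage_pair_second_countable _
  (@measurable _ (lebesgueType R)) _ _ _ `[0, T]%classic y u _ _ _ _ rV_second_countable cF.
apply.
- exact: measurable0.
- by move=> A B; exact: measurableI.
- by move=> G; exact: bigcupT_measurable.
- move=> V oV; apply: measurableI; first exact: measurable_itv_lebesgue.
  apply: measurable_lebesgueT; apply: open_measurable.
  by move/continuousP : cy; exact.
- by move=> V; exact: control_measurable.
- exact: lray_open.
Qed.

Variables (C l : R).
Hypotheses (l0 : 0 < l) (FC : forall x v, `|F x v| <= C)
  (Fl : forall x y v, `|F x v - F y v| <= l * `|x - y|).
Variables (u : control U T) (tau : R) (x : 'rV[R]_d).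
Hypothesis Ttau : `[0, T]%classic tau.

Let C0 : 0 <= C. Proof. exact: le_trans (FC 0 (u 0)). Qed.

Lemma rhs_integrable (y : R -> 'rV[R]_d) : continuous y ->
  vintegrable T (fun s => F (y s) (u s)).
Proof.
move=> cy i; apply: (@bounded_integrable_leb1 _ _ _ _ C).
  exact: measurable_rhs.
by move=> s _; apply: le_trans (rV_coord_le _ _) _.
Qed.

(** Precomposing with this retraction onto [[0, T]] makes the iterates Lipschitz on the whole line,
    so that no subspace topology is involved. *)
Definition clampT (t : R) : R := Num.max 0 (Num.min t T).

Lemma clampT_in t : `[0, T]%classic (clampT t).
Proof. by rewrite /= in_itv /= /clampT le_max lexx /= ge_max T0 ge_min lexx orbT. Qed.

Lemma clampT_id t : `[0, T]%classic t -> clampT t = t.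
Proof.
by rewrite /= in_itv /= /clampT => /andP[t0 tT]; rewrite (min_idPl _) // (max_idPr _).
Qed.

Lemma clampT_lipschitz t t' : `|clampT t - clampT t'| <= `|t - t'|.
Proof.
rewrite /clampT /Num.max /Num.min.
by case: ifPn; case: ifPn; case: ifPn; case: ifPn; rewrite -?leNgt => *;
  rewrite ler_norml; apply/andP; split; have := ler_norm (t - t');
  have := ler_norm (t' - t); rewrite -?(distrC t t') => *; lra.
Qed.

Fixpoint picard n : R -> 'rV[R]_d :=
  if n is n'.+1 then
    fun t => x + vint tau (clampT t) (fun s => F (picard n' s) (u s))
  else cst x.

Lemma vint_rhs_lipschitz (y : R -> 'rV[R]_d) t t' : continuous y ->
  `|(x + vint tau (clampT t) (fun s => F (y s) (u s))) -
    (x + vint tau (clampT t') (fun s => F (y s) (u s)))| <= C * `|t - t'|.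
Proof.
move=> cy; have iy := rhs_integrable cy.
rewrite opprD addrACA subrr add0r.
rewrite -(vint_chasles iy Ttau (clampT_in t') (clampT_in t)) addrC addKr.
apply: le_trans (vint_lipschitz iy (clampT_in _) (clampT_in _) (fun s _ => FC _ _)) _.
by rewrite ler_wpM2l // clampT_lipschitz.
Qed.

Lemma picard_lipschitz n t t' : `|picard n t - picard n t'| <= C * `|t - t'|.
Proof.
elim: n t t' => [|n IH] t t' /=; first by rewrite subrr normr0 mulr_ge0.
by apply: vint_rhs_lipschitz; exact: lipschitz_continuous_rV.
Qed.

Lemma picard_continuous n : continuous (picard n).
Proof. exact/lipschitz_continuous_rV/picard_lipschitz. Qed.

(** In the weighted norm Picard's operator contracts by 1 / 2 whatever the length of [[0, T]];
    [C * T] bounds the first increment. *)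
Lemma picard_diff n t : `[0, T]%classic t ->
  `|picard n.+1 t - picard n t| <= C * T / 2 ^+ n * expR (2 * l * `|t - tau|).
Proof.
have l20 : 0 < 2 * l by rewrite mulr_gt0.
elim: n t => [|n IH] t Tt.
  rewrite /= [X in `|X|]addrAC subrr add0r clampT_id // expr0 divr1.
  have := vint_lipschitz (rhs_integrable (@picard_continuous 0%N)) Ttau Tt (fun s _ => FC _ _).
  move=> /le_trans; apply.
  rewrite -[leLHS]mulr1 ler_pM ?mulr_ge0 ?one_le_weight //.
  rewrite ler_wpM2l //; move: Tt Ttau; rewrite /= !in_itv /= => /andP[? ?] /andP[? ?].
  by rewrite ler_norml; apply/andP; split; lra.
have in1 := rhs_integrable (@picard_continuous n.+1).
have in0 := rhs_integrable (@picard_continuous n).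
rewrite [picard n.+2 t]/= [X in _ - X]/= opprD addrACA subrr add0r clampT_id //.
rewrite -(vintB in1 in0) //.
have := @vint_norm_le _ _ T _ tau t (2 * l) (l * (C * T / 2 ^+ n)) (cst 0)
  (vintegrableB in1 in0) Ttau Tt l20.
rewrite Rintegral_leb1_cst0.
have -> : l * (C * T / 2 ^+ n) / (2 * l) = C * T / 2 ^+ n.+1.
  by rewrite exprS; field; rewrite expf_neq0 // gt_eqF.
rewrite addr0; apply => //.
- by rewrite !mulr_ge0 ?(ltW l0) ?invr_ge0 ?exprn_ge0.
- exact: integrable_leb1_cst.
- move=> s Ts; rewrite addr0; apply: le_trans (Fl _ _ _) _.
  by rewrite -mulrA ler_wpM2l ?(ltW l0) // IH.
Qed.

Lemma solves_exists : exists y, solves T F u tau x y.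
Proof.
pose W := expR (2 * l * T).
(* [W] bounds the weight on [[0, T]]; the added 1 makes the increments strictly smaller than
   [K / 2 ^+ n], as balls require. *)
pose K := C * T * W + 1.
have W0 : 0 < W by exact: expR_gt0.
have K0 : 0 < K by rewrite ltr_wpDl // mulr_ge0 ?(ltW W0) // mulr_ge0.
have l20 : 0 < 2 * l by rewrite mulr_gt0.
have pE n t : picard n t = picard n (clampT t).
  by case: n => //= n; rewrite (clampT_id (clampT_in t)).
have dn t n : ball (picard n t) (K / 2 ^+ n) (picard n.+1 t).
  rewrite pE (pE n.+1) -ball_normE /= distrC.
  apply: le_lt_trans (picard_diff n (clampT_in t)) _.
  apply: (@le_lt_trans _ _ (C * T / 2 ^+ n * W)).
    rewrite ler_wpM2l ?weight_le //; first by rewrite divr_ge0 ?exprn_ge0 // mulr_ge0.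
    exact: clampT_in.
  by rewrite mulrAC ltr_pM2r ?invr_gt0 ?exprn_gt0 // ltrDl.
have cv t : cvg ((fun n => picard n t) @ \oo).
  by apply: cauchy_cvg; exact: geometric_cauchy K0 (dn t).
pose y t := lim ((fun n => picard n t) @ \oo).
have yn t n : `|y t - picard n t| <= 2 * K / 2 ^+ n.
  apply/ler_addgt0Pr => e e0.
  have /cvgrPdist_lt /(_ _ e0) [m _ hm] := cv t.
  have := hm (n + m)%N (leq_addl _ _); rewrite -/(y t) => ym.
  have := geometric_ball n m K0 (dn t); rewrite -ball_normE /= distrC => nm.
  rewrite -[y t](subrK (picard (n + m)%N t)) -addrA addrC.
  by apply: le_trans (ler_normD _ _) _; rewrite lerD // ltW.
have cy : continuous y.
  apply: (@lipschitz_continuous_rV C) => t t'.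
  apply: (@le_geometric _ _ _ (2 * K + 2 * K)) => n.
  have -> : y t - y t' = (y t - picard n t) + (picard n t - picard n t') + (picard n t' - y t').
    by rewrite !subrKA.
  have := yn t' n; rewrite distrC => yt'; have yt := yn t n.
  apply: le_trans (ler_normD _ _) _.
  apply: le_trans (lerD (ler_normD _ _) (lexx _)) _.
  have := picard_lipschitz n t t'; rewrite mulrDl; lra.
have iy := rhs_integrable cy.
exists y; split => // t Tt; apply/eqP; rewrite -subr_eq0 -normr_le0.
(* The integral equation holds up to the distance from [y] to [picard n.+1] plus the integral, over
   a length at most [T], of the change of [F] between [picard n] and [y]. *)
apply: (@le_geometric _ _ _ (2 * K + l * (2 * K) * T)) => n; rewrite add0r.
have in0 := rhs_integrable (@picard_continuous n).
have -> : y t - (x + vint tau t (fun s => F (y s) (u s))) = (y t - picard n.+1 t) +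
   vint tau t (fun s => F (picard n s) (u s) - F (y s) (u s)).
  rewrite (vintB in0 iy) //= clampT_id // opprD !addrA; congr (_ - _).
  by rewrite opprD addrA subrK.
apply: le_trans (ler_normD _ _) _; rewrite mulrDl; apply: lerD.
  apply: le_trans (yn _ _) _; rewrite ler_pM2l ?mulr_gt0 //.
  by rewrite lef_pV2 ?posrE ?exprn_gt0 // exprS ler_peMl ?exprn_ge0 // ler1n.
have {}Fn s : `[0, T]%classic s ->
    `|F (picard n s) (u s) - F (y s) (u s)| <= l * (2 * K / 2 ^+ n).
  by move=> _; apply: le_trans (Fl _ _ _) _; rewrite ler_pM2l // distrC.
have := vint_lipschitz (vintegrableB in0 iy) Ttau Tt Fn.
move=> /le_trans; apply.
have -> : l * (2 * K) * T / 2 ^+ n = l * (2 * K / 2 ^+ n) * T by ring.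
rewrite ler_wpM2l //; first by rewrite !mulr_ge0 ?(ltW l0) ?(ltW K0) ?invr_ge0 ?exprn_ge0.
move: Tt Ttau; rewrite /= !in_itv /= => /andP[? ?] /andP[? ?].
by rewrite ler_norml; apply/andP; split; lra.
Qed.

End picard.

Section clamp.
Context {R : realType} {d : nat}.
Implicit Types x y : 'rV[R]_d.

Definition clampv (rho : R) x : 'rV[R]_d :=
  \row_i Num.max (- rho) (Num.min rho (x ord0 i)).

Lemma clampv_norm_le rho x : 0 <= rho -> `|clampv rho x| <= rho.
Proof.
move=> rho0; apply: rV_norm_le => // i; rewrite mxE ler_norml.
by rewrite le_max lexx /= ge_max ge_min lexx /= andbT; lra.
Qed.

Lemma clampv_norm_le_id rho x : 0 <= rho -> `|clampv rho x| <= `|x|.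
Proof.
move=> rho0; apply: rV_norm_le => // i; apply: le_trans (rV_coord_le x i).
rewrite mxE; set z := x ord0 i; rewrite /Num.max /Num.min.
by case: ifPn; case: ifPn; rewrite -?leNgt => *; rewrite ler_norml; apply/andP;
  split; have := ler_norm z; have := ler_norm (- z); rewrite ?normrN => *; lra.
Qed.

Lemma clampv_lipschitz rho x y : `|clampv rho x - clampv rho y| <= `|x - y|.
Proof.
apply: rV_norm_le => // i; apply: le_trans (rV_coord_le (x - y) i).
rewrite !mxE; set a := x ord0 i; set b := y ord0 i; rewrite /Num.max /Num.min.
by case: ifPn; case: ifPn; case: ifPn; case: ifPn; rewrite -?leNgt => *;
  rewrite ler_norml; apply/andP; split; have := ler_norm (a - b);
  have := ler_norm (b - a); rewrite -?(distrC a b) => *; lra.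
Qed.

Lemma clampv_id rho x : `|x| <= rho -> clampv rho x = x.
Proof.
move=> xrho; apply/rowP => i; rewrite mxE.
have := le_trans (rV_coord_le x i) xrho; rewrite ler_norml => /andP[x1 x2].
by rewrite (min_idPr _) // (max_idPr _).
Qed.

Lemma clampv_continuous rho : continuous (clampv rho).
Proof.
move=> x; have FF : Filter (nbhs x) := nbhs_filter _.
apply/cvgrPdist_lt => e e0; apply: filterS (nbhsx_ballx x e e0) => y.
by rewrite -ball_normE /=; apply: le_lt_trans; exact: clampv_lipschitz.
Qed.

End clamp.

(** * Existence and stability of the controlled flow *)

Section flows.
Context {R : realType} {U : metricType R} {d : nat}.
Variables (T : R) (f : 'rV[R]_d -> U -> 'rV[R]_d) (m : R).
Hypothesis T0 : 0 <= T.
Hypothesis cU : compact [set: U].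
Hypothesis f_cont : continuous (uncurry f).
Hypothesis m0 : 0 < m.
Hypothesis f_growth : forall x u, `|f x u| <= m * (1 + `|x|).
Hypothesis f_lip : forall rho : R, exists2 l : R, 0 < l &
  forall x y u, `|x| <= rho -> `|y| <= rho -> `|f x u - f y u| <= l * `|x - y|.

Lemma vint_eq (g h : R -> 'rV[R]_d) (a b : R) :
  (forall s, `[0, T]%classic s -> g s = h s) ->
  `[0, T]%classic a -> `[0, T]%classic b -> vint a b g = vint a b h.
Proof.
move=> gh Ta Tb; apply/rowP => i; rewrite !mxE /oriented_int.
by case: ifP => _; [|congr (- _)]; apply: eq_Rintegral => s /set_mem sab;
  rewrite gh //; apply: subset_segment sab.
Qed.

Lemma solves_eq (F G : 'rV[R]_d -> U -> 'rV[R]_d) u tau x y :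
  `[0, T]%classic tau ->
  (forall s, `[0, T]%classic s -> F (y s) (u s) = G (y s) (u s)) ->
  solves T F u tau x y -> solves T G u tau x y.
Proof.
move=> Ttau FG [iy yE]; split.
  move=> i; apply: eq_integrable (iy i); first exact: measurable_itv_lebesgue.
  by move=> s /set_mem Ts /=; rewrite FG.
by move=> t Tt; rewrite yE //; congr (_ + _); exact: vint_eq.
Qed.

(* Precomposed with clampv rho, the field f becomes bounded and globally Lipschitz
   while keeping its growth bound; by the latter, the solution stays in the ball
   of radius rho, where nothing has changed. *)
Lemma solution_exists (u : control U T) tau x : `[0, T]%classic tau ->
  exists y, solves T f u tau x y.
Proof.
move=> Ttau; pose rho := 2 * (1 + `|x|) * expR (2 * m * T).
have rho0 : 0 <= rho by rewrite !mulr_ge0 ?expR_ge0 // addr_ge0.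
have [l l0 fl] := f_lip rho.
pose F z v := f (clampv rho z) v.
have cF : continuous (uncurry F).
  have -> : uncurry F = uncurry f \o (fun p : 'rV[R]_d * U => (clampv rho p.1, p.2)).
    by apply/funext => -[].
  move=> p; apply: continuous_comp; last exact: f_cont.
  apply: (@cvg_pair _ _ _ _ (nbhs (clampv rho p.1)) (nbhs p.2)).
    by apply: (@continuous_comp _ _ _ fst (clampv rho)); [exact: cvg_fst|exact: clampv_continuous].
  exact: cvg_snd.
have [y sy] : exists y, solves T F u tau x y.
  apply: (@solves_exists _ _ _ T F T0 cF (m * (1 + rho)) l l0) => //.
    move=> z v; apply: le_trans (f_growth _ _) _.
    by rewrite ler_pM2l // lerD2l clampv_norm_le.
  move=> z z' v; apply: le_trans (fl _ _ _ _ _) _; rewrite ?clampv_norm_le //.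
  by rewrite ler_pM2l // clampv_lipschitz.
exists y; apply: (solves_eq Ttau _ sy) => // s Ts; rewrite /F clampv_id //.
have Fm z v : `|F z v| <= m * (1 + `|z|).
  apply: le_trans (f_growth _ _) _.
  by rewrite ler_pM2l // lerD2l clampv_norm_le_id.
apply: le_trans (solves_growth Ttau m0 Fm sy Ts).
by rewrite lerDr.
Qed.

(** Uniform continuity gives [e] when the controls are within [r]; beyond [r] the trivial bound on
    the difference is at most [C * mdist v v'], by the choice of [C] as that bound divided by
    [r]. *)
Lemma rhs_modulus (rho e : R) : 0 < e -> exists2 C : R, 0 <= C &
  forall a v v', `|a| <= rho -> `|f a v - f a v'| <= e + C * mdist v v'.
Proof.
move=> e0; pose K : set 'rV[R]_d := [set a | `|a| <= rho].
have cK : compact K by exact: rV_ball_compact.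
have cKU : compact (K `*` [set: U]) by exact: compact_setX.
have [r r0 hr] := @compact_unif_continuous _ _ _ _ (uncurry f) e cKU (fun p _ => @f_cont p) e0.
exists (2 * (m * (1 + `|rho|)) / r).
  by rewrite !mulr_ge0 ?invr_ge0 ?(ltW r0) ?(ltW m0).
move=> a v v' arho; have [vv'|rvv'] := ltP (mdist v v') r.
  have := hr (a, v) (a, v') (conj arho I).
  rewrite -ball_normE /= => h.
  apply: le_trans (ltW (h _)) _.
    by split => /=; [exact: ballxx|rewrite ballEmdist].
  by rewrite lerDl !mulr_ge0 ?invr_ge0 ?mdist_ge0 ?(ltW r0) ?(ltW m0).
apply: (@le_trans _ _ (2 * (m * (1 + `|rho|)))).
  apply: le_trans (ler_normB _ _) _.
  have fa w : `|f a w| <= m * (1 + `|rho|).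
    by apply: le_trans (f_growth _ _) _; rewrite ler_pM2l // lerD2l (le_trans arho) // ler_norm.
  by have := fa v; have := fa v'; lra.
apply: ler_wpDl; first exact: ltW.
rewrite -mulrA ler_peMr //; first by rewrite !mulr_ge0 ?(ltW m0).
by rewrite mulrC ler_pdivlMr // mul1r.
Qed.

(** The bound of [solves_growth] for initial states of norm at most [rho]; it holds in both
    directions of time. *)
Definition state_bound (rho : R) := 2 * (1 + rho) * expR (2 * m * T).

Lemma solution_bound u tau x y rho : `[0, T]%classic tau ->
  solves T f u tau x y -> `|x| <= rho ->
  forall t, `[0, T]%classic t -> `|y t| <= state_bound rho.
Proof.
move=> Ttau sy xrho t Tt; apply: (@le_trans _ _ (1 + `|y t|)); first by rewrite lerDr.
apply: le_trans (solves_growth Ttau m0 f_growth sy Tt) _.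
by rewrite ler_wpM2r ?expR_ge0 // ler_pM2l // lerD2l.
Qed.

Lemma solution_lipschitz u tau x y rho : `[0, T]%classic tau ->
  solves T f u tau x y -> `|x| <= rho ->
  forall t t', `[0, T]%classic t -> `[0, T]%classic t' ->
    `|y t - y t'| <= m * (1 + state_bound rho) * `|t - t'|.
Proof.
move=> Ttau sy xrho t t' Tt Tt'; have [iy yE] := sy.
rewrite !yE // opprD addrACA subrr add0r.
rewrite -(vint_chasles iy Ttau Tt' Tt) addrC addKr.
apply: vint_lipschitz => // s Ts; apply: le_trans (f_growth _ _) _.
by rewrite ler_pM2l // lerD2l (solution_bound Ttau sy).
Qed.

Lemma solution_stable (rho e : R) : 0 < e -> exists2 r : R, 0 < r &
  forall (u u' : control U T) tau x x' y y', `[0, T]%classic tau ->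
    `|x| <= rho -> `|x'| <= rho -> `|x - x'| < r ->
    Rintegral leb1 `[0, T] (fun s => mdist (u s) (u' s)) < r ->
    solves T f u tau x y -> solves T f u' tau x' y' ->
    forall t, `[0, T]%classic t -> `|y t - y' t| <= e.
Proof.
move=> e0.
have [l l0 fl] := f_lip (state_bound rho).
pose W := expR (2 * l * T); have W0 : 0 < W := expR_gt0 _.
(* The bracket in [solves_compare] may reach [e / (2 * W)]. One half pays for [e1 * T], the other
   for [r + C * r], which covers the initial states and the controls. The constants are chosen in
   the order [e1], [C], [r]. *)
pose e1 := e / (2 * W) / (2 * (T + 1)).
have T1 : 0 < T + 1 by rewrite ltr_wpDl.
have e10 : 0 < e1 by rewrite !divr_gt0 // !mulr_gt0.
have [C C0 fC] := rhs_modulus (state_bound rho) e10.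
pose r := e / (2 * W) / (2 * (C + 1)).
have C1 : 0 < C + 1 by rewrite ltr_wpDl.
have r0 : 0 < r by rewrite !divr_gt0 // !mulr_gt0.
exists r => // u u' tau x x' y y' Ttau xrho x'rho xx' uu' sy sy' t Tt.
have := solves_compare cU Ttau l0 (ltW e10) C0 (fun a b v => @fl a b v) fC sy sy'
  (solution_bound Ttau sy xrho) (solution_bound Ttau sy' x'rho) Tt.
move=> /le_trans; apply; rewrite -/W.
set I := Rintegral _ _ _ in uu' *.
have h1 : C * I <= C * r by rewrite ler_wpM2l // ltW.
have h2 : e1 * T + e1 = e / (2 * W) / 2 by rewrite /e1; field; rewrite !gt_eqF.
have h3 : C * r + r = e / (2 * W) / 2 by rewrite /r; field; rewrite !gt_eqF.
have h4 : `|x - x'| + (e1 * T + C * I) <= e / (2 * W) by lra.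
apply: (@le_trans _ _ (2 * (e / (2 * W)) * W)); first by rewrite ler_pM2r // ler_pM2l.
by rewrite le_eqVlt; apply/orP; left; apply/eqP; field; rewrite gt_eqF.
Qed.

(** A solution is chosen for each initial datum, and stability with equal controls makes the choice
    continuous in [x]. Hence the [xget] defining [flow] never falls back on its default. *)
Lemma is_flow_exists (u : control U T) : exists Phi, is_flow f T u Phi.
Proof.
pose S tau x := @xget (R -> 'rV[R]_d) (fun=> x) [set y | solves T f u tau x y].
have SP tau x : `[0, T]%classic tau -> solves T f u tau x (S tau x).
  move=> Ttau; have [y sy] := solution_exists u x Ttau.
  by apply: (@xgetPex _ _ [set y | solves T f u tau x y]); exists y.
exists (fun tau t x => S tau x t) => tau t Ttau Tt; split; last first.
  by move=> x; have [iy yE] := SP tau x Ttau; split => //; rewrite {1}yE.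
move=> x; have FF : Filter (nbhs x) := nbhs_filter _.
apply/cvgrPdist_le => e e0.
have [r r0 h] := solution_stable (`|x| + 1) e0.
have r1 : 0 < Num.min r 1 by rewrite lt_min r0 ltr01.
apply: filterS (nbhsx_ballx x _ r1) => x'.
rewrite -ball_normE /= lt_min => /andP[xx'r xx'1].
apply: (h u u tau x x') => //; [by rewrite lerDl| | |exact: SP|exact: SP].
- rewrite distrC in xx'1; rewrite -[x'](subrK x); apply: le_trans (ler_normD _ _) _.
  by rewrite addrC lerD2l ltW.
- rewrite (_ : Rintegral _ _ _ = 0) // /Rintegral integral0_eq // => s _.
  by rewrite mdistxx.
Qed.

Lemma flowP (u : control U T) : is_flow f T u (flow f T u).
Proof.
have [Phi PhiP] := is_flow_exists u.
by apply: (@xgetPex _ _ [set Phi | is_flow f T u Phi]); exists Phi.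
Qed.

Lemma flow_solves (u : control U T) tau x : `[0, T]%classic tau ->
  solves T f u tau x (fun t => flow f T u tau t x).
Proof.
move=> Ttau; split; first by have [_ /(_ x)[]] := flowP u Ttau Ttau.
by move=> t Tt; have [_ /(_ x)[_]] := flowP u Ttau Tt.
Qed.

(** The second trajectory is restarted at [tau], which trades the change of initial time for a small
    change of initial state; the final time is then moved along that same trajectory. *)
Lemma flow_stable (rho e : R) : 0 < e -> exists2 r : R, 0 < r &
  forall (u u' : control U T) tau tau' t t' x,
    `[0, T]%classic tau -> `[0, T]%classic tau' ->
    `[0, T]%classic t -> `[0, T]%classic t' ->
    `|x| <= rho -> `|tau - tau'| < r -> `|t - t'| < r ->
    Rintegral leb1 `[0, T] (fun s => mdist (u s) (u' s)) < r ->
    `|flow f T u tau t x - flow f T u' tau' t' x| <= e.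
Proof.
move=> e0; have e2 : 0 < e / 2 by rewrite divr_gt0.
(* The restarted state is only known to have norm at most [state_bound rho]. *)
have [r r0 h] := solution_stable (Num.max rho (state_bound rho)) e2.
pose L := m * (1 + `|state_bound rho|) + 1.
have L0 : 0 < L by rewrite ltr_wpDl // mulr_ge0 ?(ltW m0).
exists (Num.min r (Num.min (r / L) (e / 2 / L))).
  by rewrite !lt_min r0 !divr_gt0.
move=> u u' tau tau' t t' x Ttau Ttau' Tt Tt' xrho.
rewrite !lt_min => /and3P[_ taur _] /and3P[_ _ tr] /and3P[ur _ _].
have sy := flow_solves u x Ttau; have sy' := flow_solves u' x Ttau'.
have sy'' := solves_restart Ttau' Ttau sy'.
have lip s s' : `[0, T]%classic s -> `[0, T]%classic s' ->
    `|flow f T u' tau' s x - flow f T u' tau' s' x| <= L * `|s - s'|.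
  move=> Ts Ts'; apply: le_trans (solution_lipschitz Ttau' sy' xrho Ts Ts') _.
  rewrite ler_wpM2r // /L ler_wpDr // ler_pM2l // lerD2l; exact: ler_norm.
rewrite [e]splitr.
rewrite -(subrKA (flow f T u' tau' t x)).
apply: le_trans (ler_normD _ _) _; apply: lerD; last first.
  apply: le_trans (lip t t' Tt Tt') _.
  by rewrite mulrC -ler_pdivlMr // ltW.
apply: (h u u' tau x (flow f T u' tau' tau x)
  (fun t => flow f T u tau t x) (fun t => flow f T u' tau' t x)) => //.
- by rewrite le_max xrho.
- by rewrite le_max (solution_bound Ttau' sy') ?orbT.
- rewrite -{1}(solves_start Ttau' sy') distrC.
  apply: le_lt_trans (lip tau tau' Ttau Ttau') _.
  by rewrite mulrC -ltr_pdivlMr.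
Qed.

End flows.

(** * Continuity of the Koopman operators *)

Section koopman_continuity.
Context {R : realType} {U : metricType R} {d : nat}.
Variables (T : R) (f : 'rV[R]_d -> U -> 'rV[R]_d) (m : R).
Hypothesis T0 : 0 <= T.
Hypothesis cU : compact [set: U].
Hypothesis f_cont : continuous (uncurry f).
Hypothesis m0 : 0 < m.
Hypothesis f_growth : forall x u, `|f x u| <= m * (1 + `|x|).
Hypothesis f_lip : forall rho : R, exists2 l : R, 0 < l &
  forall x y u, `|x| <= rho -> `|y| <= rho -> `|f x u - f y u| <= l * `|x - y|.
Variable phi : compactly_supported R d.
Local Notation normc := (@ComplexField.Normc.normc R).
Local Notation K := (closure [set x | phi x != 0]).

Lemma cs_out x : ~ K x -> phi x = 0.
Proof.
move=> nKx; apply/eqP; apply/negP => /negP phix0; apply: nKx.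
exact: subset_closure.
Qed.

Lemma cs_unif_continuous (e : R) : 0 < e -> exists2 r : R, 0 < r &
  forall x y, `|x - y| < r -> normc (phi x - phi y) <= e.
Proof.
move=> e0.
(* R[i] is not a pseudometric space over R: uniform continuity is obtained from
   the continuity of h on the diagonal of K, where h vanishes. *)
pose h (p : 'rV[R]_d * 'rV[R]_d) := normc (phi p.1 - phi p.2).
have ch : continuous h.
  move=> p; apply: (@continuous_comp _ R[i]^o _
    (fun p : 'rV[R]_d * 'rV[R]_d => phi p.1 - phi p.2) normc); last exact: normc_continuous.
  apply: (@cvgB _ R[i]^o).
    by apply: (@continuous_comp _ _ R[i]^o fst phi); [exact: cvg_fst|exact: cs_continuous].
  by apply: (@continuous_comp _ _ R[i]^o snd phi); [exact: cvg_snd|exact: cs_continuous].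
have cA : compact ((fun x : 'rV[R]_d => (x, x)) @` K).
  apply: continuous_compact; last exact: cs_compact.
  apply: continuous_subspaceT => x.
  by apply: (@cvg_pair _ _ _ (nbhs x) (nbhs x) (nbhs x)); exact: cvg_id.
have [r r0 hr] := @compact_unif_continuous _ _ _ _ h e cA (fun p _ => @ch p) e0.
have key x y : K x -> `|x - y| < r -> normc (phi x - phi y) <= e.
  move=> Kx xy.
  have hxy : ball (h (x, x)) e (h (x, y)).
    apply: hr; first by exists x.
    by split => /=; [exact: ballxx|rewrite -ball_normE].
  move: hxy; rewrite /h /= subrr ComplexField.Normc.normc0 -ball_normE /= sub0r normrN.
  by move=> /ltW; apply: le_trans; exact: ler_norm.
exists r => // x y xy; have [Kx|nKx] := pselect (K x); first exact: key.
have [Ky|nKy] := pselect (K y).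
  by rewrite -normcN opprB; apply: key => //; rewrite distrC.
by rewrite !cs_out // subrr ComplexField.Normc.normc0 ltW.
Qed.

Lemma cs_support_bounded : exists2 rho : R, 0 <= rho & forall x, K x -> `|x| <= rho.
Proof.
have /compact_bounded[M [_ hM]] := @cs_compact _ _ phi.
exists (`|M| + 1) => // x; apply: hM.
by rewrite (le_lt_trans (ler_norm M)) // ltrDl.
Qed.

(** The trajectory is restarted at [t] and followed back to [tau]. Preimages of bounded sets are
    thus bounded, uniformly in the control, which preserves compact supports. *)
Lemma flow_preimage_bound (u : control U T) tau t x rho :
  `[0, T]%classic tau -> `[0, T]%classic t ->
  `|flow f T u tau t x| <= rho -> `|x| <= state_bound T m rho.
Proof.
move=> Ttau Tt xrho.
have sy := flow_solves T0 cU f_cont m0 f_growth f_lip u x Ttau.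
have sy' := solves_restart Ttau Tt sy.
have := solution_bound m0 f_growth Tt sy' xrho Ttau.
by rewrite (solves_start Ttau sy).
Qed.

Lemma cs_flow (u : control U T) tau t : `[0, T]%classic tau ->
  `[0, T]%classic t -> exists psi : compactly_supported R d,
    (psi : 'rV[R]_d -> R[i]) = phi \o flow f T u tau t.
Proof.
move=> Ttau Tt.
have [cPhi _] := flowP T0 cU f_cont m0 f_growth f_lip u Ttau Tt.
have [rho rho0 Krho] := cs_support_bounded.
have cphi : continuous (phi \o flow f T u tau t : 'rV[R]_d -> R[i]^o).
  by move=> x; apply: continuous_comp; [exact: cPhi|exact: cs_continuous].
pose A := flow f T u tau t @^-1` K.
have clA : closed A by apply: closed_comp; [move=> x _; exact: cPhi|exact: closed_closure].
have cA : compact A.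
  apply: bounded_closed_compact => //.
  exists (state_bound T m rho); split; first exact: num_real.
  move=> M rM x /Krho xrho; apply: le_trans (ltW rM).
  exact: flow_preimage_bound xrho.
have cs : compact (closure [set x | (phi \o flow f T u tau t) x != 0]).
  apply: subclosed_compact cA _; first exact: closed_closure.
  rewrite [X in _ `<=` X]((closure_id A).1 clA); apply: closure_subset => x /= ?.
  exact: subset_closure.
by exists (CompactlySupported cphi cs).
Qed.

(* The times are clamped to [0, T] to get a map that is continuous on the whole plane. *)
Definition koopman_map (p : R * R) (u : controls cU T) : compactly_supported R d :=
  sval (cid (cs_flow (repr u) (clampT_in T0 p.1) (clampT_in T0 p.2))).

Lemma koopman_mapE (p : R * R) (u : controls cU T) : time_square T p ->
  (koopman_map p u : 'rV[R]_d -> R[i]) = phi \o controlled_flow f u p.1 p.2.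
Proof.
move=> [p1 p2]; rewrite /koopman_map; case: cid => /= psi ->.
by rewrite !clampT_id.
Qed.

Lemma koopman_map_continuous :
  continuous (fun w : (R * R) * controls cU T => koopman_map w.1 w.2).
Proof.
move=> [p u] A /nbhs_ballP[e /= e0 eA].
have e2 : 0 < e / 2 by rewrite divr_gt0.
have [r r0 hr] := cs_unif_continuous e2.
have r2 : 0 < r / 2 by rewrite divr_gt0.
have [rho rho0 Krho] := cs_support_bounded.
have [s s0 hs] := flow_stable T0 cU f_cont m0 f_growth f_lip (state_bound T m rho) r2.
apply/nbhs_ballP; exists s => //= -[p' u'] /= [[/= p1 p2] uu'].
apply: eA; rewrite ballEmdist /=.
apply: (@le_lt_trans _ _ (e / 2)); last by rewrite ltr_pdivrMr // ltr_pMr // ltr1n.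
apply: ge_sup; first exact: (cs_has_sup _ _).1.
move=> _ [x _ <-]; rewrite /koopman_map; case: cid => /= a ->; case: cid => /= b ->.
have T1 := clampT_in T0 p.1; have T2 := clampT_in T0 p.2.
have T1' := clampT_in T0 p'.1; have T2' := clampT_in T0 p'.2.
(* Trajectories issued from outside the ball miss the support of phi. *)
have [xrho|xrho] := leP `|x| (state_bound T m rho).
  apply: hr; apply: (@le_lt_trans _ _ (r / 2)); last by rewrite ltr_pdivrMr // ltr_pMr // ltr1n.
  apply: hs => //.
  - by apply: le_lt_trans p1; exact: clampT_lipschitz.
  - by apply: le_lt_trans p2; exact: clampT_lipschitz.
have out (v : control U T) q : ~ K (flow f T v (clampT T q.1) (clampT T q.2) x).
  move=> /Krho /(flow_preimage_bound (clampT_in T0 _) (clampT_in T0 _)).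
  by rewrite leNgt xrho.
by rewrite /= (cs_out (@out _ p)) (cs_out (@out _ p')) subrr ComplexField.Normc.normc0 ltW.
Qed.

End koopman_continuity.

(** * Measurable selection of zeros *)

Section completed_algebra.
Context {disp : measure_display} {O : measurableType disp} {R : realType}.
Variable mu : {measure set O -> \bar R}.
Local Notation completed := (completed_algebra_gen mu).

Lemma completed_measurable (A : set O) : measurable A -> completed A.
Proof. by move=> mA; exists A => //; exists set0; [exact: negligible_set0|rewrite setU0]. Qed.

Lemma completedU_negligible (A N : set O) : completed A -> mu.-negligible N ->
  completed (A `|` N).
Proof.
move=> [B mB [N' nN' <-]] nN; exists B => //; exists (N' `|` N); last by rewrite setUA.
exact: negligibleU.
Qed.

Lemma completedD_negligible (A N : set O) : completed A -> mu.-negligible N ->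
  completed (A `\` N).
Proof.
(* [N] need not be measurable: a measurable null set [M] around it is removed from [B], and what was
   removed in excess goes into the negligible part. *)
move=> [B mB [N' nN' <-]] [M [mM M0 NM]]; exists (B `\` M); first exact: measurableD.
exists (((B `&` M) `|` N') `\` N); last first.
  apply/seteqP; split => [x [[Bx nMx]|[[[Bx Mx]|N'x] nNx]]|x [[Bx|N'x] nNx]].
  - by split; [left|move=> /NM].
  - by split; [left|].
  - by split; [right|].
  - by have [Mx|nMx] := pselect (M x); [right; split => //; left|left].
  - by right; split => //; right.
apply: negligibleS (negligibleU (negligibleS (@subIsetr _ B M) (_ : mu.-negligible M)) nN').
  exact: subDsetl.
by exists M; split.
Qed.

Lemma completed_ae (A A' N : set O) : completed A -> mu.-negligible N ->
  A `\` N = A' `\` N -> completed A'.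
Proof.
move=> cA nN AA'; rewrite -(setUIDK A' N) -AA' setUC.
apply: completedU_negligible; first exact: completedD_negligible.
exact: negligibleS nN.
Qed.

Lemma completed_bigcup (F : nat -> set O) :
  (forall n, completed (F n)) -> completed (\bigcup_n F n).
Proof.
move=> cF; pose B n := sval (cid2 (cF n)).
have BP n : measurable (B n) /\ exists2 N, mu.-negligible N & B n `|` N = F n.
  by rewrite /B; case: cid2.
have [N NP] := choice (fun n => (exists2P _ _).1 (BP n).2).
exists (\bigcup_n B n); first by apply: bigcupT_measurable => n; have [] := BP n.
exists (\bigcup_n N n); first by apply: negligible_bigcup => n; have [] := NP n.
by rewrite -bigcupU; apply: eq_bigcup => // n _; have [] := NP n.
Qed.

Lemma completedI : setI_closed completed.
Proof.
move=> A A' cA [B mB [N nN <-]].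
apply: (@completed_ae (A `&` B) _ N) => //; last first.
  by apply/seteqP; split => [x [[Ax Bx] nNx]|x [[Ax [Bx|//]] nNx]]; split => //; split => //; left.
move: cA => [C mC [N' nN' <-]]; exists (C `&` B); first exact: measurableI.
exists (N' `&` B); last by rewrite -setIUl.
exact: negligibleS nN'.
Qed.

End completed_algebra.

(** * Measurable hulls and the choice of a branch *)

Section branch_selection.
Context {disp : measure_display} {O : measurableType disp} {R : realType}.
Variable mu : {measure set O -> \bar R}.
Variable D : set O.
Hypotheses (mD : measurable D) (muD : (mu D < +oo)%E).

(** [H] has the least measure among the measurable sets between [A] and [D]. As [H]&[B] competes
    with it, and measures inside [D] are finite, nothing of positive measure can lie in [H] outside
    [B]. *)
Lemma measurable_hull (A : set O) : A `<=` D -> exists H, [/\ measurable H,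
  A `<=` H & forall B, measurable B -> A `<=` B -> mu (H `\` B) = 0%E].
Proof.
move=> AD; pose S := [set mu B | B in [set B | [/\ measurable B, A `<=` B & B `<=` D]]].
have Sfin : ereal_inf S \is a fin_num.
  rewrite ge0_fin_numE; last by apply: le_ereal_inf_tmp => _ [B _ <-].
  by apply: (le_lt_trans _ muD); apply: ereal_inf_lbound; exists D => //; split.
have hB n : exists B, [/\ measurable B, A `<=` B, B `<=` D &
    (mu B < ereal_inf S + n.+1%:R^-1%:E)%E].
  have n0 : 0 < n.+1%:R^-1 :> R by rewrite invr_gt0.
  by have [_ [B [mB AB BD] <-] ltB] := lb_ereal_inf_adherent n0 Sfin; exists B.
have [B BP] := choice hB.
pose H := \bigcap_n B n.
have mH : measurable H by apply: bigcapT_measurable => n; have [] := BP n.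
have AH : A `<=` H by move=> x Ax n _; have [_ + _ _] := BP n; exact.
have HD : H `<=` D by move=> x /(_ 0%N I); have [_ _ + _] := BP 0%N; exact.
exists H; split => // C mC AC.
have muH : (mu H <= ereal_inf S)%E.
  apply/lee_addgt0Pr => e e0.
  have [n _ ne] := near_infty_natSinv_lt (PosNum e0).
  have {}ne := ne n (leqnn n); rewrite /= in ne.
  have [mB _ _ ltB] := BP n.
  apply: (@le_trans _ _ (mu (B n))); first by apply: le_measure; rewrite ?inE //; exact: bigcap_inf.
  by apply: le_trans (ltW ltB) _; rewrite leeD2l // lee_fin ltW.
have mHC : measurable (H `&` C) by exact: measurableI.
have HCS : (ereal_inf S <= mu (H `&` C))%E.
  apply: ereal_inf_lbound; exists (H `&` C) => //; split => //.
    by move=> x Ax; split; [exact: AH|exact: AC].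
  by move=> x [/HD].
have muHfin : (mu H < +oo)%E.
  by apply: le_lt_trans muD; apply: le_measure; rewrite ?inE.
rewrite measureD //; apply/eqP; rewrite eq_le; apply/andP; split; last first.
  rewrite sube_ge0; first by apply: le_measure; rewrite ?inE //; exact: subIsetl.
  by rewrite ge0_fin_numE // (le_lt_trans _ muHfin) // le_measure ?inE //; exact: subIsetl.
rewrite leeBlDr ?add0e //; first exact: le_trans muH HCS.
by rewrite ge0_fin_numE // (le_lt_trans _ muHfin) // le_measure ?inE //; exact: subIsetl.
Qed.

Definition least (P : nat -> Prop) : nat :=
  if pselect (exists j, `[< P j >]) is left h then ex_minn h else 0%N.

Lemma leastP (P : nat -> Prop) : (exists j, P j) -> P (least P).
Proof.
move=> [j Pj]; rewrite /least; case: pselect => [h|]; last by case; exists j; apply/asboolP.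
by case: ex_minnP => k /asboolP.
Qed.

Lemma least_le (P : nat -> Prop) j : P j -> (least P <= j)%N.
Proof.
move=> Pj; rewrite /least; case: pselect => // h; case: ex_minnP => k _; apply.
exact/asboolP.
Qed.

Lemma measurable_least (G : nat -> set O) j : (forall k, measurable (G k)) ->
  measurable (D `&` [set p | least (fun k => G k p) = j]).
Proof.
move=> mG.
(* The second term accounts for the default: [least] is 0 at points belonging to no [G k]. *)
have -> : D `&` [set p | least (fun k => G k p) = j] =
  (D `&` (G j `\` \bigcup_(i < j) G i)) `|`
  (D `&` (if j == 0%N then ~` \bigcup_i G i else set0)).
  apply/seteqP; split => p.
    move=> [Dp /= pj]; have [[k Gk]|nG] := pselect (exists k, G k p).
      left; split => //; split; first by rewrite -pj; apply: (@leastP (fun k => G k p)); exists k.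
      by move=> [i /= ij Gi]; have := least_le (P := fun k => G k p) Gi; rewrite pj leqNgt ij.
    right; split => //; suff j0 : j = 0%N by rewrite j0 eqxx; move=> [k _ Gk]; apply: nG; exists k.
    rewrite -pj /least; case: pselect => // h; exfalso; apply: nG.
    by case: h => k /asboolP; exists k.
  move=> [[Dp [Gj nG]]|[Dp h]]; split => //=.
    apply/eqP; rewrite eqn_leq least_le // leqNgt; apply/negP => lt; apply: nG.
    by exists (least (fun k => G k p)) => //; apply: (@leastP (fun k => G k p)); exists j.
  move: h; case: ifP => [/eqP -> nG|_ []]; rewrite /least; case: pselect => // h; exfalso; apply: nG.
  by case: h => k /asboolP; exists k.
apply: measurableU; apply: measurableI => //.
  apply: measurableD => //; exact: bigcup_measurable.
case: ifP => // _; apply: measurableC; exact: bigcupT_measurable.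
Qed.

Variables (E : nat -> nat -> set O) (r : nat -> nat -> nat -> Prop).
Hypothesis mE : forall n j, measurable (E n j).

Definition branch (p : O) (s : nat -> nat) :=
  forall n, E n (s n) p /\ r n (s n) (s n.+1).

Lemma branch_selection : exists2 N, mu.-negligible N & exists s : O -> nat -> nat,
  (forall n j, measurable (D `&` [set p | s p n = j])) /\
  forall p, D p -> ~ N p -> (exists s', branch p s') -> branch p (s p).
Proof.
pose A n j := [set p | D p /\ exists s, s n = j /\
  forall k, (n <= k)%N -> E k (s k) p /\ r k (s k) (s k.+1)].
have AD n j : A n j `<=` D by move=> p [].
have [h hP] := choice (fun nj : nat * nat => measurable_hull (@AD nj.1 nj.2)).
pose H0 n j := h (n, j).
have HP n j : [/\ measurable (H0 n j), A n j `<=` H0 n j &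
    forall B, measurable B -> A n j `<=` B -> mu (H0 n j `\` B) = 0%E] := hP (n, j).
(* A hull may stick out of [E n j]; after this intersection, following the sets [H] enforces the
   condition [E] by itself. *)
pose H n j := H0 n j `&` E n j.
have mH n j : measurable (H n j) by apply: measurableI => //; have [] := HP n j.
have AH n j : A n j `<=` H n j.
  move=> p Ap; split; first by have [_ + _] := HP n j; exact.
  by move: Ap => [_ [s [<- /(_ n (leqnn n))[]]]].
pose G n j k := if `[< r n j k >] then H n.+1 k else set0.
have mG n j k : measurable (G n j k) by rewrite /G; case: ifP.
pose N := \bigcup_n \bigcup_j (H n j `\` \bigcup_k G n j k).
exists N.
  apply: negligible_bigcup => n; apply: negligible_bigcup => j.
  have mU : measurable (\bigcup_k G n j k) by exact: bigcupT_measurable.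
  exists (H0 n j `\` \bigcup_k G n j k); split.
  - by apply: measurableD => //; have [] := HP n j.
  - have [_ _] := HP n j; apply => // p [Dp [s [sn hs]]].
    have [_ rn] := hs n (leqnn n).
    exists (s n.+1) => //; rewrite /G -sn; case: asboolP => // _.
    apply: AH; split => //; exists s; split => // k nk; apply: hs; exact: ltnW.
  - by apply: setSD; exact: subIsetl.
pose s p := fix s n := if n is n'.+1 then least (fun k => G n' (s n') k p)
  else least (fun k => H 0%N k p).
exists s; split.
  elim=> [|n IH] j; first exact: measurable_least.
  have -> : D `&` [set p | s p n.+1 = j] = \bigcup_i
    ((D `&` [set p | s p n = i]) `&` (D `&` [set p | least (fun k => G n i k p) = j])).
    apply/seteqP; split => [p [Dp /= <-]|p [i _ [[Dp /= <-] [_ /= <-]]]] //.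
    by exists (s p n).
  by apply: bigcupT_measurable => i; apply: measurableI => //; exact: measurable_least.
move=> p Dp nNp [s' bs'].
(* Off [N] some [G n (s p n) k] contains [p], so [least] returns a genuine index rather than its
   default. *)
have step n : H n (s p n) p -> H n.+1 (s p n.+1) p /\ r n (s p n) (s p n.+1).
  move=> Hn; have : exists k, G n (s p n) k p.
    apply: contrapT => nG; apply: nNp; exists n => //; exists (s p n) => //; split => //.
    by move=> [k _ Gk]; apply: nG; exists k.
  move=> /(@leastP (fun k => G n (s p n) k p)); rewrite -/(s p n.+1).
  by rewrite {1}/G; case: asboolP.
have Hs n : H n (s p n) p.
  elim: n => [|n /step[]//]; apply: (@leastP (fun k => H 0%N k p)).
  exists (s' 0%N); apply: AH; split => //; exists s'; split => // k _; exact: bs'.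
by move=> n; have [_ En] := Hs n; split => //; exact: (step n (Hs n)).2.
Qed.

End branch_selection.

(** * From branches to zeros *)

Section zero_selection.
Context {R : realType}.

Lemma continuous_mdist (X : metricType R) :
  continuous (fun w : X * X => mdist w.1 w.2).
Proof.
move=> [x y]; have FF : Filter (nbhs (x, y)) := nbhs_filter _.
apply/cvgrPdist_lt => e e0.
have e2 : 0 < e / 2 by rewrite divr_gt0.
apply: filterS (nbhsx_ballx (x, y) _ e2) => -[x' y'] [/=].
rewrite !ballEmdist /= => xx' yy'.
have := metric_triangle x x' y; have := metric_triangle x' y' y.
have := metric_triangle x' x y'; have := metric_triangle x y y'.
rewrite (metric_sym x' x) (metric_sym y' y) => *.
by rewrite ltr_distlC; apply/andP; split; lra.
Qed.

Lemma fast_cvg_le (Y : metricType R) (a : nat -> Y) (l : Y) n :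
  (forall n, mdist (a n) (a n.+1) <= 4^-1 ^+ n) -> a @ \oo --> l ->
  mdist (a n) l <= 4 / 2 ^+ n.
Proof.
move=> fa /metricType_numDomainType.cvgrPdist_lt al.
(* The rate is weakened to a strict bound with [K = 2]; the sum [2 * K] of [geometric_ball] is then
   the 4 of the conclusion. *)
have dn k : ball (a k) (2 / 2 ^+ k) (a k.+1).
  rewrite ballEmdist /=; apply: le_lt_trans (fa k) _.
  rewrite -exprVn; apply: (@le_lt_trans _ _ (2^-1 ^+ k)).
    by rewrite lerXn2r ?nnegrE // lef_pV2 ?posrE // ler_nat.
  by rewrite ltr_pMl ?exprn_gt0 // ltr1n.
apply/ler_addgt0Pr => e e0; have [m _ hm] := al e e0.
have lm := hm (n + m)%N (leq_addl _ _).
have := geometric_ball n m (ltr0n R 2) dn; rewrite ballEmdist /= => nm.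
apply: le_trans (metric_triangle _ (a (n + m)%N) _) _.
apply: lerD; last by rewrite metric_sym ltW.
by apply: le_trans (ltW nm) _; rewrite -natrM.
Qed.

Context {disp : measure_display} {O : measurableType disp}.
Variables (mu : {measure set O -> \bar R}) (D : set O).
Hypotheses (mD : measurable D) (muD : (mu D < +oo)%E).
Variables (Y : metricType R) (q : nat -> Y).
Hypothesis q_dense : forall y e, 0 < e -> exists n, mdist (q n) y < e.
Hypothesis Y_complete : forall a : nat -> Y,
  (forall n, mdist (a n) (a n.+1) <= 4^-1 ^+ n) -> exists l : Y, a @ \oo --> l.
Variable h : O -> Y -> R.
Hypothesis h_ge0 : forall p y, 0 <= h p y.
Hypothesis h_cont : forall p, continuous (h p).
Hypothesis h_meas : forall n j,
  measurable (D `&` [set p | h p (q j) < 2^-1 ^+ n]).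

Let E n j := D `&` [set p | h p (q j) < 2^-1 ^+ n].
Let r n j k := mdist (q j) (q k) <= 4^-1 ^+ n.

Lemma branch_exists p : D p -> (exists y, h p y = 0) -> exists s, branch E r p s.
Proof.
move=> Dp [y hy].
(* Half of [4^-1 ^+ n], so that two successive points, compared through [y], are within [4^-1 ^+ n]
   of each other. *)
have near_y n : exists j, mdist (q j) y < 4^-1 ^+ n / 2 /\ h p (q j) < 2^-1 ^+ n.
  have n0 : 0 < 2^-1 ^+ n :> R by rewrite exprn_gt0.
  have hc : h p z @[z --> y] --> h p y := @h_cont p y.
  move: hc; rewrite hy => /cvgr_lt /(_ _ n0) /nbhs_ballP[e /= e0 he].
  have [|j] := @q_dense y (Num.min e (4^-1 ^+ n / 2)).
    by rewrite lt_min e0 divr_gt0 // exprn_gt0.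
  rewrite lt_min => /andP[je jn]; exists j; split => //.
  by apply: he; rewrite ballEmdist /= metric_sym.
have [s sP] := choice near_y.
exists s => n; have [s1 s2] := sP n; have [s3 _] := sP n.+1.
split; first by split.
rewrite /r; apply: le_trans (metric_triangle _ y _) _.
rewrite (metric_sym y) [leRHS]splitr lerD ?ltW //.
apply: lt_le_trans s3 _; rewrite ler_pM2r // exprS ler_piMl ?exprn_ge0 //.
by rewrite invf_le1 ?ler1n // ltr0n.
Qed.

Lemma zero_selection : exists2 N, mu.-negligible N & exists u : O -> Y,
  (forall V, open V -> measurable (D `&` u @^-1` V)) /\
  forall p, D p -> ~ N p -> (exists y, h p y = 0) -> h p (u p) = 0.
Proof.
have [N nN [s [ms bs]]] := @branch_selection _ _ _ mu D mD muD E r h_meas.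
exists N => //.
pose fast p := forall n, r n (s p n) (s p n.+1).
pose u p := if pselect (fast p) is left H then sval (cid (Y_complete H)) else q 0%N.
have u_lim p : fast p -> (fun n => q (s p n)) @ \oo --> u p.
  by move=> fp; rewrite /u; case: pselect => // H; case: cid.
have u_le p n : fast p -> mdist (q (s p n)) (u p) <= 4 / 2 ^+ n.
  by move=> fp; exact: (@fast_cvg_le _ (fun n => q (s p n)) _ n fp (u_lim p fp)).
pose G := D `&` fast.
have mG : measurable G.
  have -> : G = \bigcap_n (\bigcup_j \bigcup_k
      ((D `&` [set p | s p n = j]) `&`
       (if `[< r n j k >] then D `&` [set p | s p n.+1 = k] else set0))).
    apply/seteqP; split => [p [Dp fp] n _|p Gp].
      exists (s p n) => //; exists (s p n.+1) => //; split => //.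
      by case: asboolP => // /(_ (fp n)).
    have Dp : D p by have [j _ [k _ [[]]]] := Gp 0%N I.
    split => // n; have [j _ [k _ [[_ /= sn]]]] := Gp n I.
    by case: asboolP => // rn [_ /= sk]; rewrite sn sk.
  apply: bigcapT_measurable => n; apply: bigcupT_measurable => j.
  apply: bigcupT_measurable => k; apply: measurableI => //.
  by case: ifP.
exists u; split; last first.
  move=> p Dp nNp hy; have b := bs p Dp nNp (branch_exists Dp hy).
  have fp : fast p by move=> n; exact: (b n).2.
  have hu : (fun n => h p (q (s p n))) @ \oo --> h p (u p).
    by apply: (@cvg_comp _ _ _ (fun n => q (s p n)) (h p)); [exact: u_lim|exact: h_cont].
  apply/eqP; rewrite eq_le h_ge0 andbT.
  have h0 : (fun n => geometric (1 : R) (2^-1) n) @ \oo --> (0 : R).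
    by apply: cvg_geometric; rewrite gtr0_norm ?invf_lt1 // ltr1n.
  apply: (ler_cvg_to hu h0); near=> n; rewrite /geometric /= mul1r.
  by have [[_ /ltW]] := b n.
move=> V oV.
(* On [G], [u p] lies in [V] exactly when, for some [n], the closed ball of radius [4 / 2 ^+ n]
   about [q (s p n)] is contained in [V]. That ball always contains [u p] and has diameter at most
   [8 / 2 ^+ n], hence the 8 below. Off [G], [u] is the constant [q 0]. *)
have -> : D `&` u @^-1` V =
  (G `&` \bigcup_n \bigcup_j (if `[< [set y | mdist (q j) y <= 4 / 2 ^+ n] `<=` V >] then
     D `&` [set p | s p n = j] else set0)) `|`
  ((D `\` G) `&` (if `[< V (q 0%N) >] then setT else set0)).
  apply/seteqP; split => p.
    move=> [Dp /= Vu]; have [fp|nfp] := pselect (fast p); last first.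
      right; split; first by split => // -[].
      case: asboolP => // -[]; move: Vu; rewrite /u; case: pselect => //.
    left; split => //.
    have /nbhs_ballP[e /= e0 eV] := open_nbhs_nbhs (conj oV Vu).
    have [n ltn] := geometric_small 8 e0.
    exists n => //; exists (s p n) => //; case: asboolP => // -[] y /= yq.
    apply: eV; rewrite ballEmdist /=.
    apply: le_lt_trans (metric_triangle _ (q (s p n)) _) _.
    rewrite metric_sym; have := u_le p n fp; lra.
  move=> [[[Dp fp] [n _ [j _]]]|[[Dp nG]]].
    case: asboolP => // jV [_ /= sn]; split => //; apply: jV => /=.
    by rewrite -sn; exact: u_le.
  case: asboolP => // Vq _; split => //=; rewrite /u.
  by case: pselect => // fp; exfalso; apply: nG; split.
apply: measurableU.
  apply: measurableI => //; apply: bigcupT_measurable => n.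
  by apply: bigcupT_measurable => j; case: ifP.
by apply: measurableI; [exact: measurableD|case: ifP].
Unshelve. all: by end_near. Qed.

End zero_selection.

(** * The space of controls is complete and separable *)

Section controls_complete.
Context {R : realType} {U : metricType R}.
Variables (cU : compact [set: U]) (T : R).
Local Notation D := (`[0, T]%classic : set (lebesgueType R)).

Lemma compact_mdist_bounded : exists2 M : R, 0 < M & forall x y : U, mdist x y <= M.
Proof.
have [[x0]|nU] := pselect (exists x : U, True); last first.
  by exists 1 => // x; exfalso; apply: nU; exists x.
have /compact_near_coveringP/(_ R +oo%R) := cU.
move=> /(_ (fun M x => mdist x0 x < M)) [|M [_ hM]]; last first.
  have {}hM x : mdist x0 x < M + 1 by apply: hM => //; rewrite ltrDl.
  exists (M + 1 + (M + 1)).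
    by rewrite addr_gt0 // (le_lt_trans _ (hM x0)) // mdist_ge0.
  move=> x y; apply: le_trans (metric_triangle _ x0 _) _.
  by rewrite lerD // ltW // metric_sym.
move=> x _; exists (ball x 1, [set i | mdist x0 x + 1 < i]).
  by split => /=; [exact: nbhsx_ballx|exact/nbhs_pinfty_gt/num_real].
move=> [y i] /= []; rewrite ballEmdist /= => xy.
apply: lt_trans; apply: le_lt_trans (metric_triangle _ x _) _.
by rewrite ltrD2l.
Qed.

Lemma compact_cauchy_cvg_metric (a : nat -> U) :
  cauchy (a @ \oo) -> exists l : U, a @ \oo --> l.
Proof.
move=> ca.
pose U' : pseudoPMetricType R := HB.pack U (PseudoMetric.on U) (isPointed.Build U (a 0%N)).
have := @compact_cauchy_cvg U' setT (a @ \oo) _ ca filterT cU.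
move=> al; exists (lim (a @ \oo : set_system U')); exact: al.
Qed.

(** A limit lies in [O] exactly when the sequence eventually stays in some [Oj]. Staying in [O]
    itself would not do, as the limit could reach its boundary. *)
Lemma pointwise_limit_control (v : nat -> control U T) (E : set R) (w : R -> U) :
  measurable (E : set (lebesgueType R)) -> E `<=` D ->
  (forall t, E t -> (fun n => v n t) @ \oo --> w t) ->
  (forall t, ~ E t -> w t = v 0%N t) ->
  forall O : set U, open O -> measurable (D `&` w @^-1` O : set (lebesgueType R)).
Proof.
move=> mE ED vw w0 O oO.
pose Oj (j : nat) : set U := [set x | ball x j.+1%:R^-1 `<=` O]°.
have oOj j : open (Oj j) by exact: open_interior.
have -> : D `&` w @^-1` O =
  (E `&` \bigcup_j \bigcup_k \bigcap_(n in [set n | (k <= n)%N]) (D `&` v n @^-1` Oj j))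
  `|` ((D `&` v 0%N @^-1` O) `\` E).
  apply/seteqP; split => t.
    move=> [Dt Owt]; have [Et|nEt] := pselect (E t); last first.
      by right; split => //; split => //=; rewrite -w0.
    left; split => //.
    have /nbhs_ballP[e /= e0 eO] := open_nbhs_nbhs (conj oO Owt).
    have e2 : 0 < e / 2 by rewrite divr_gt0.
    have [j _ je] := near_infty_natSinv_lt (PosNum e2).
    have {}je := je j (leqnn j); rewrite /= in je.
    exists j => //.
    have wOj : Oj j (w t).
      apply/nbhs_ballP; exists j.+1%:R^-1 => //= x wx y xy; apply: eO.
      rewrite [e]splitr; apply: (@ball_triangle _ _ x).
        by apply: le_ball wx; exact: ltW.
      by apply: le_ball xy; exact: ltW.
    have [k _ hk] := vw t Et _ (open_nbhs_nbhs (conj (oOj j) wOj)).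
    by exists k => // n /= kn; split => //; exact: hk.
  move=> [[Et [j _ [k _ hk]]]|[[Dt vO] nEt]]; last by split => //=; rewrite w0.
  split; first exact: ED.
  have [n _ hn] := vw t Et _ (nbhsx_ballx (w t) j.+1%:R^-1 (ltac:(by []))).
  have [_ /interior_subset] := hk (maxn k n) (leq_maxl _ _).
  by apply; apply: ball_sym; apply: hn => /=; exact: leq_maxr.
apply: measurableU; last first.
  by apply: measurableD => //; exact: control_measurable.
apply: measurableI => //; apply: bigcupT_measurable => j.
apply: bigcupT_measurable => k; apply: bigcap_measurable; first by exists k => /=.
by move=> n _; exact: control_measurable.
Qed.

(** The Riesz-Fischer argument: representatives of a fast sequence converge almost everywhere, and,
    [U] being bounded, dominated convergence turns this into convergence for the integral
    distance. *)
Lemma controls_complete (a : nat -> controls cU T) :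
  (forall n, mdist (a n) (a n.+1) <= 4^-1 ^+ n) ->
  exists l : controls cU T, a @ \oo --> l.
Proof.
move=> fa; pose v n : control U T := repr (a n).
(* The sum S of the g n has integral at most 2; where it is finite,
   mdist (v n t) (v n.+1 t) <= S t / 2 ^+ n. *)
pose g n (t : lebesgueType R) := (2 ^+ n * mdist (v n t) (v n.+1 t)) %:E.
have mD := @measurable_itv_lebesgue R `[0, T].
have mg n : measurable_fun D (g n).
  apply/measurable_EFinP; apply: measurable_funM; first exact: measurable_cst.
  exact: measurable_mdist.
have g0 n t : (0 <= g n t)%E by rewrite lee_fin mulr_ge0 ?exprn_ge0 // mdist_ge0.
pose S t := (\sum_(0 <= n <oo) g n t)%E.
have iS : leb1.-integrable D S.
  apply/integrableP; split; first exact: ge0_emeasurable_sum.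
  under eq_integral do rewrite gee0_abs ?nneseries_ge0 //.
  rewrite integral_nneseries //.
  (* The integral of [g n] is at most [2 ^+ n * 4^-1 ^+ n], that is [2^-1 ^+ n], here in the form
     expected by [epsilon_trick]. *)
  apply: (@le_lt_trans _ _ (\sum_(0 <= n <oo) (0 + (2 / (2 ^ n.+1)%:R)%:E))%E).
    apply: lee_nneseries => [n _|n _]; first by move=> *; apply: integral_ge0.
    have -> : (\int[leb1]_(t in D) g n t =
        (2 ^+ n)%:E * \int[leb1]_(t in D) (mdist (v n t) (v n.+1 t))%:E)%E.
      under eq_integral do rewrite /g EFinM.
      rewrite ge0_integralZl //; try by rewrite lee_fin exprn_ge0.
        by apply/measurable_EFinP; exact: measurable_mdist.
      by move=> t _; rewrite lee_fin mdist_ge0.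
    rewrite -[X in (_ * X)%E]fineK ?integral_mdist_fin // -EFinM add0e lee_fin.
    apply: le_trans (_ : 2 ^+ n * 4^-1 ^+ n <= _); first by rewrite ler_pM2l ?exprn_gt0 // fa.
    rewrite -exprMn natrX exprS invfM mulrA divff // mul1r.
    by rewrite -exprVn (_ : 2 * 4^-1 = 2^-1 :> R) //; field.
  apply: le_lt_trans (epsilon_trick _ _ _) _ => //.
  by rewrite eseries0 // add0e ltry.
pose E : set R := [set t | D t /\ (S t < +oo)%E].
have mE : measurable (E : set (lebesgueType R)).
  by apply: emeasurable_fun_infty_o => //; exact: ge0_emeasurable_sum.
have cvE t : E t -> exists l : U, (fun n => v n t) @ \oo --> l.
  move=> [Dt St].
  have S0 : (0 <= S t)%E by apply: nneseries_ge0.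
  pose K := fine (S t) + 1.
  have K0 : 0 < K by rewrite ltr_wpDl // fine_ge0.
  apply: (@compact_cauchy_cvg_metric (fun n => v n t)); apply: (@geometric_cauchy _ _ _ K) => // n.
  rewrite ballEmdist /= ltr_pdivlMr ?exprn_gt0 // mulrC.
  apply: (@le_lt_trans _ _ (fine (S t))); last by rewrite ltrDl.
  rewrite -lee_fin fineK ?ge0_fin_numE //.
  apply: le_trans (nneseries_lim_ge n.+1 (fun k _ _ => g0 k t)).
  by rewrite big_nat_recr //= leeDr // sume_ge0.
pose w t := if pselect (E t) is left Et then sval (cid (cvE t Et)) else v 0%N t.
have vw t : E t -> (fun n => v n t) @ \oo --> w t.
  by move=> Et; rewrite /w; case: pselect => // Et'; case: cid.
have w0 t : ~ E t -> w t = v 0%N t by rewrite /w; case: pselect.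
have mw := pointwise_limit_control mE (fun t => @proj1 _ _) vw w0.
pose W := Control mw.
exists (\pi_(controls cU T) W)%qT.
apply/metricType_numDomainType.cvgrPdist_lt => e e0.
have aE n : mdist (\pi_(controls cU T) W)%qT (a n) =
    Rintegral leb1 `[0, T] (fun t => mdist (v n t) (W t)).
  by rewrite -[a n]reprK metric_sym mdist_pi.
have [M M0 hM] := compact_mdist_bounded.
have [] := @dominated_convergence _ _ R leb1 D mD
  (fun n t => (mdist (v n t) (W t))%:E) (cst 0%E) (cst M%:E).
- by move=> n; apply/measurable_EFinP; exact: measurable_mdist.
- exact: measurable_cst.
- apply: filterS (integrable_ae mD iS) => t St Dt.
  have Et : E t by split => //; move: (St Dt); rewrite ge0_fin_numE // nneseries_ge0.
  apply: cvg_EFin; first by near=> n.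
  apply/cvgrPdist_lt => r r0.
  have /metricType_numDomainType.cvgrPdist_lt /(_ r r0) := vw t Et.
  apply: filterS => n; rewrite /= sub0r normrN ger0_norm ?mdist_ge0 // metric_sym.
  exact.
- exact: integrable_leb1_cst.
- by apply: aeW => t n _; rewrite gee0_abs ?lee_fin ?mdist_ge0.
move=> _ _; rewrite integral_cst // mul0e => /fine_cvgP[_] /cvgr_lt /(_ _ e0).
by apply: filterS => n; rewrite aE.
Unshelve. all: by end_near. Qed.

End controls_complete.

(** * Density of countably many step controls *)

Section controls_dense.
Context {R : realType} {U : metricType R}.
Variables (cU : compact [set: U]) (T : R).
Hypothesis T0 : 0 <= T.
Local Notation D := (`[0, T]%classic : set (lebesgueType R)).

(** [A] is a Borel set up to a null set, and inner regularity is applied to that Borel part. *)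
Lemma leb1_inner_regular (A : set R) (e : R) :
  measurable (A : set (lebesgueType R)) -> (leb1 A < +oo)%E -> 0 < e ->
  exists V : set R, [/\ compact V, V `<=` A & (leb1 (A `\` V) < e%:E)%E].
Proof.
move=> mA Afin e0.
have : completed_algebra_gen (@lebesgue_measure R) A.
  by rewrite -g_sigma_completed_algebra_genE completed_caratheodory_measurable.
move=> [B mB [N nN BNA]].
have BA : B `<=` A by rewrite -BNA; exact: subsetUl.
have Bfin : (lebesgue_measure B < +oo)%E.
  by apply: le_lt_trans Afin; exact: le_outer_measure.
have [V [cV VB BV]] := lebesgue_regularity_inner mB Bfin e0.
exists V; split => //; first exact: subset_trans BA.
apply: le_lt_trans BV.
move: nN => [M [mM M0 NM]].
apply: (@le_trans _ _ (lebesgue_measure (B `\` V) + lebesgue_measure M)%E); last first.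
  by rewrite M0 adde0.
apply: le_trans (outer_measureU2 _ _ _).
apply: le_outer_measure => x [Ax nVx]; move: Ax; rewrite -BNA => -[Bx|/NM]; last by right.
by left.
Qed.

Lemma compact_ball_subset {X : pseudoMetricType R} (A O : set X) :
  compact A -> open O -> A `<=` O ->
  exists2 r : R, 0 < r & forall x, A x -> ball x r `<=` O.
Proof.
move=> cA oO AO.
have /compact_near_coveringP/(_ _ (0^'+ : set_system R)) := cA.
move=> /(_ (fun r x => ball x r `<=` O)) [].
  move=> x Ax.
  have /nbhs_ballP[r /= r0 rO] := open_nbhs_nbhs (conj oO (AO x Ax)).
  exists (ball x (r / 2), [set s | s < r / 2]).
    split => /=; first by apply: nbhsx_ballx; rewrite divr_gt0.
    by apply: nbhs_right_lt; rewrite divr_gt0.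
  move=> [x' s] /= [xx' sr] y x'y; apply: rO.
  by rewrite [r]splitr; apply: ball_triangle xx' _; apply: le_ball x'y; exact: ltW.
move=> r /= r0 hr; exists (r / 2); first by rewrite divr_gt0.
have r2 : 0 < r / 2 by rewrite divr_gt0.
move=> x Ax; apply: (hr (r / 2)) => //=.
by rewrite sub0r normrN gtr0_norm // ltr_pdivrMr // ltr_pMr // ltr1n.
Qed.

Lemma compact_net (e : R) : 0 < e ->
  exists s : seq U, forall x, exists2 c, c \in s & mdist x c < e.
Proof.
move=> e0.
have [[x0]|nU] := pselect (exists x : U, True); last first.
  by exists [::] => x; exfalso; apply: nU; exists x.
pose U' : pseudoPMetricType R := HB.pack U (PseudoMetric.on U) (isPointed.Build U x0).
have := cU; rewrite -[compact _]/(compact [set: U']) compact_cover.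
move=> /(_ U' setT (fun c : U' => (ball c e)°)) [].
- by move=> c _; exact: open_interior.
- by move=> x _; exists x => //; exact: nbhsx_ballx.
move=> s _ hs; exists (finmap.enum_fset s) => x.
have [c cs /interior_subset xc] := hs x I.
by exists c => //; move: (ball_sym xc); rewrite (@ballEmdist R U).
Qed.

Definition net (n : nat) : seq U := sval (cid (@compact_net n.+1%:R^-1 (ltac:(by [])))).

Lemma netP n x : exists2 c, c \in net n & mdist x c < n.+1%:R^-1.
Proof. by rewrite /net; case: cid. Qed.

Definition cell (n : nat) (t : R) : nat := Num.truncn (t * n.+1%:R).

Variable x0 : U.

(** The index codes, by integers only, the precision of a finite net of [U], the mesh of a grid and,
    for each cell, the rank of the value in the net. The family is therefore countable. *)
Definition step_fun (i : nat * nat * seq nat) (t : R) : U :=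
  nth x0 (net i.1.1) (nth 0%N i.2 (cell i.1.2 t)).

Lemma cell_itv n k : (fun t => 0 <= t) `&` [set t | cell n t = k] =
  `[k%:R / n.+1%:R, k.+1%:R / n.+1%:R[%classic.
Proof.
apply/seteqP; split => t.
  move=> [t0 /= <-]; rewrite in_itv /= ler_pdivrMr // ltr_pdivlMr //.
  by rewrite truncn_le ?mulr_ge0 //= truncnS_gt.
rewrite /= in_itv /= ler_pdivrMr // ltr_pdivlMr // => /andP[kt tk].
have t0 : 0 <= t by rewrite -(pmulr_lge0 _ (ltr0Sn R n)) (le_trans _ kt).
split => //; rewrite /cell; apply/eqP; rewrite truncn_eq ?mulr_ge0 //.
by rewrite kt tk.
Qed.

Lemma step_measurable i (O : set U) : open O ->
  measurable (D `&` step_fun i @^-1` O : set (lebesgueType R)).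
Proof.
move=> oO.
have -> : D `&` step_fun i @^-1` O = D `&` \bigcup_k
   (if `[< O (nth x0 (net i.1.1) (nth 0%N i.2 k)) >] then
   `[k%:R / i.1.2.+1%:R, k.+1%:R / i.1.2.+1%:R[%classic else set0).
  apply/seteqP; split => t [Dt].
    move=> /= Ot; split => //; exists (cell i.1.2 t) => //.
    case: asboolP => [_|nO]; last by exfalso; apply: nO; exact: Ot.
    rewrite -cell_itv; split => //.
    by move: Dt; rewrite /= in_itv /= => /andP[].
  move=> [k _]; case: asboolP => // Ok; rewrite -cell_itv => -[_ /= tk].
  by split => //; rewrite /step_fun /= tk.
apply: measurableI; first exact: measurable_itv_lebesgue.
apply: bigcupT_measurable => k; case: ifP => // _.
exact: measurable_itv_lebesgue.
Qed.

Definition step_control i : control U T := Control (@step_measurable i).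

(* The level sets of the index of the first net point close to u are replaced by
   disjoint compact subsets; on a grid finer than their mutual distances, every
   cell meets at most one of them. *)
Lemma step_control_dense (u : control U T) (e : R) : 0 < e ->
  exists i, Rintegral leb1 `[0, T] (fun t => mdist (step_control i t) (u t)) < e.
Proof.
move=> e0.
have mD := @measurable_itv_lebesgue R `[0, T].
have [M M0 hM] := compact_mdist_bounded cU.
have T1 : 0 < T + 1 by rewrite ltr_wpDl.
(* Budget: on the compact sets the error is at most [k.+1%:R^-1], which integrates to less than
   [e / 2]; elsewhere it is at most [M], on a set of measure at most [N%:R * e'], for less than
   [e / 4]. *)
have eta0 : 0 < e / (2 * (T + 1)) by rewrite divr_gt0 // mulr_gt0.
have [k _ ke] := near_infty_natSinv_lt (PosNum eta0).
have {}ke := ke k (leqnn k); rewrite /= in ke.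
pose N := size (net k); pose c j := nth x0 (net k) j.
pose B j := D `&` [set t | (j < N)%N /\ mdist (u t) (c j) < k.+1%:R^-1].
have mB j : measurable (B j : set (lebesgueType R)).
  rewrite /B; case: (ltnP j N) => jN; last first.
    by rewrite (_ : _ `&` _ = set0) //; apply/seteqP; split => // t [_ []].
  have mc (O : set U) : open O -> measurable (D `&` cst (c j) @^-1` O : set (lebesgueType R)).
    move=> _; have [cO|ncO] := pselect (O (c j)).
      by rewrite (_ : _ @^-1` _ = setT) ?setIT //; apply/seteqP; split.
    by rewrite (_ : _ @^-1` _ = set0) ?setI0 //; apply/seteqP; split.
  have := measurable_mdist cU u (Control mc) mD (measurable_itv `]-oo, k.+1%:R^-1[).
  congr (measurable _); apply/seteqP; split => t [Dt] /=; rewrite in_itv /=.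
    by split.
  by move=> [].
have DB : D `<=` \bigcup_j B j.
  move=> t Dt; have [c' c's uc'] := netP k (u t).
  exists (index c' (net k)) => //; split => //; split; first by rewrite index_mem.
  by rewrite /c nth_index.
pose A := seqDU B.
have mA j : measurable (A j : set (lebesgueType R)) by exact: seqDU_measurable.
have AB j : A j `<=` B j by exact: subset_seqDU.
have Afin j : (leb1 (A j) < +oo)%E.
  apply: le_lt_trans (leb1_itv_lty 0 T); apply: le_outer_measure.
  by move=> t /AB [].
pose e' := e / (4 * M * N.+1%:R).
have e'0 : 0 < e' by rewrite divr_gt0 // !mulr_gt0.
have [K KP] := choice (fun j => leb1_inner_regular (mA j) (Afin j) e'0).
have cK j : compact (K j) by have [] := KP j.
have KA j : K j `<=` A j by have [] := KP j.
have Kuniq i j t : K i t -> K j t -> i = j.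
  move=> /KA Ai /KA Aj; have /trivIsetP := trivIset_seqDU B.
  move=> /(_ i j I I); have [->//|_ /(_ isT)] := eqVneq i j.
  by move=> /seteqP[/(_ t) h _]; exfalso; apply: h.
have hr i : exists2 r : R, 0 < r & forall t t' j, K i t -> `|t - t'| < r ->
    (j < N)%N -> K j t' -> j = i.
  have oC : open (~` \bigcup_(j in [set j | (j < N)%N /\ j <> i]) K j).
    apply: closed_openC; apply: closed_bigcup.
      by apply: sub_finite_set (finite_II N) => j [].
    by move=> j _; apply: compact_closed => //; exact: Rhausdorff.
  have [|r r0 hr] := compact_ball_subset (cK i) oC.
    by move=> t Kit [j [_ ji] Kjt]; apply: ji; exact: Kuniq Kjt Kit.
  exists r => // t t' j Kit tt' jN Kjt'; apply: contrapT => ji.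
  have := hr t Kit t'; rewrite -ball_normE /= => /(_ tt'); apply.
  by exists j.
have [r rP] := choice (fun i => (exists2P _ _).1 (hr i)).
have hn i : exists n, forall n', (n <= n')%N -> n'.+1%:R^-1 < r i.
  have ri0 : 0 < r i by have [] := rP i.
  by have [n _ hn] := near_infty_natSinv_lt (PosNum ri0); exists n => n' /hn.
have [nn nnP] := choice hn.
pose n := \max_(i < N) nn i.
have nP i t t' j : (i < N)%N -> K i t -> (j < N)%N -> K j t' ->
    cell n t = cell n t' -> 0 <= t -> 0 <= t' -> j = i.
  move=> iN Kit jN Kjt' tt' t0 t'0; have [_ h] := rP i; apply: (h t t') => //.
  apply: lt_trans (nnP i n (@leq_bigmax _ (fun i : 'I_N => nn i) (Ordinal iN))).
  have [ti ti'] : (`[(cell n t)%:R / n.+1%:R, (cell n t).+1%:R / n.+1%:R[%classic t : Prop) /\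
      (`[(cell n t)%:R / n.+1%:R, (cell n t).+1%:R / n.+1%:R[%classic t' : Prop).
    by rewrite -cell_itv; split; split.
  move: ti ti'; rewrite /= !in_itv /= -[(cell n t).+1%:R]natr1 mulrDl mul1r.
  set a := (cell n t)%:R / _; set b := n.+1%:R^-1; move: (a) (b) => {}a {}b /andP[? ?] /andP[? ?].
  by rewrite ltr_norml; apply/andP; split; lra.
(* By [nP] a cell meets at most one [K j] with [j < N]. A cell meeting none gets 0, harmlessly: all
   its points in [D] belong to the set where the error is merely bounded by [M]. *)
pose idx m : nat :=
  if pselect (exists j, (j < N)%N /\ exists t, [/\ K j t, 0 <= t & cell n t = m])
  is left h then sval (cid h) else 0%N.
have idxP j t : (j < N)%N -> K j t -> 0 <= t -> idx (cell n t) = j.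
  move=> jN Kjt t0; rewrite /idx; case: pselect => [h|nh]; last first.
    by exfalso; apply: nh; exists j; split => //; exists t.
  case: cid => j' /= [j'N [t' [Kt' t'0 tt']]].
  exact: (nP j t t' j').
exists (k, n, mkseq idx (Num.truncn (T * n.+1%:R)).+1).
pose KK := \bigcup_(j in [set j | (j < N)%N]) K j.
have KKclose t : D t -> KK t -> mdist
    (step_fun (k, n, mkseq idx (Num.truncn (T * n.+1%:R)).+1) t) (u t) <= k.+1%:R^-1.
  move=> Dt [j jN Kjt].
  have [t0 tT] : 0 <= t /\ t <= T by move: Dt; rewrite /= in_itv /= => /andP[].
  rewrite /step_fun /= nth_mkseq; last by rewrite ltnS /cell le_truncn // ler_wpM2r.
  rewrite (idxP j) // metric_sym ltW //.
  by have [_ []] := AB _ _ (KA _ _ Kjt).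
have KKm : measurable (KK : set (lebesgueType R)).
  apply: bigcup_measurable => j _; apply: measurable_lebesgueT.
  by apply: closed_measurable; apply: compact_closed => //; exact: Rhausdorff.
have mDK : measurable (D `\` KK) by exact: measurableD.
have DKK : (leb1 (D `\` KK) <= (N%:R * e')%:E)%E.
  apply: (@le_trans _ _ (leb1 (\big[setU/set0]_(j < N) (A j `\` K j)))).
    apply: le_outer_measure => t [Dt nKt].
    have := DB t Dt; rewrite seqDU_bigcup_eq => -[j _ Ajt].
    have jN : (j < N)%N by have [_ []] := AB _ _ Ajt.
    rewrite -(bigcup_mkord N (fun j => A j `\` K j)); exists j => //; split => // Kjt.
    by apply: nKt; exists j.
  apply: (le_trans (@Boole_inequality _ R _ leb1 (fun j => A j `\` K j) N _)).
    move=> j _; apply: measurableD => //; apply: measurable_lebesgueT.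
    by apply: closed_measurable; apply: compact_closed => //; exact: Rhausdorff.
  apply: (@le_trans _ _ (\sum_(j < N) e'%:E)%E).
    by apply: lee_sum => j _; have [_ _ /ltW] := KP j.
  by rewrite sumEFin lee_fin sumr_const card_ord mulr_natl.
set w := step_control _.
have iw := control_mdist_integrable w u cU.
have i1 : leb1.-integrable D (EFin \o (fun t => \1_(D `\` KK) t : R)).
  apply: (@bounded_integrable_leb1 _ _ _ _ 1); first exact: measurable_indic.
  by move=> t _; rewrite indicE; case: (_ \in _); rewrite /= ?normr1 ?normr0.
have ic := @integrable_leb1_cst R 0 T k.+1%:R^-1.
have iM : leb1.-integrable D (EFin \o (fun t => M * \1_(D `\` KK) t)).
  by have := integrableZl mD M i1.
apply: (@le_lt_trans _ _ (Rintegral leb1 `[0, T]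
  (fun t => k.+1%:R^-1 + M * \1_(D `\` KK) t))).
  apply: le_Rintegral => //; first by have := integrableD mD ic iM.
  move=> t Dt; have [Kt|nKt] := pselect (KK t).
    by apply: le_trans (KKclose t Dt Kt) _; rewrite lerDl mulr_ge0 ?(ltW M0).
  by rewrite indicE mem_set // mulr1; apply: le_trans (hM _ _) _; rewrite lerDr.
rewrite RintegralD // RintegralZl // Rintegral_cst //.
have -> : Rintegral leb1 D (fun t => \1_(D `\` KK) t) = fine (leb1 (D `\` KK)).
  by rewrite /Rintegral integral_indic // setIidl.
have -> : fine (leb1 D) = T by rewrite leb1_segment //= subr0.
have h1 : k.+1%:R^-1 * T <= e / (2 * (T + 1)) * T by rewrite ler_wpM2r // ltW.
have h2 : e / (2 * (T + 1)) * T + e / (2 * (T + 1)) = e / 2.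
  by field; rewrite gt_eqF.
have h3 : fine (leb1 (D `\` KK)) <= N%:R * e'.
  rewrite -lee_fin fineK // ge0_fin_numE //; apply: le_lt_trans DKK _; exact: ltry.
have h4 : M * fine (leb1 (D `\` KK)) <= M * (N%:R * e') by rewrite ler_pM2l.
have h5 : M * (N%:R * e') + M * e' = e / 4.
  have -> : M * (N%:R * e') + M * e' = M * (N.+1%:R * e') by rewrite -natr1; ring.
  have : N.+1%:R != 0 :> R by [].
  rewrite /e'; move: (N.+1%:R : R) => c0 c00.
  by field; rewrite c00 gt_eqF.
have h6 : 0 < M * e' by rewrite mulr_gt0.
have h7 : k.+1%:R^-1 * T < e / 2.
  by apply: le_lt_trans h1 _; rewrite -h2 ltrDl.
have h8 : M * fine (leb1 (D `\` KK)) < e / 4.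
  by apply: le_lt_trans h4 _; rewrite -h5 ltrDl.
apply: lt_trans (ltrD h7 h8) _.
by rewrite [ltRHS]splitr ltrD2l ltr_pM2l // ltf_pV2 ?posrE // ltr_nat.
Qed.

Lemma controls_dense : exists q : nat -> controls cU T,
  forall v e, 0 < e -> exists n, mdist (q n) v < e.
Proof.
pose i0 : nat * nat * seq nat := (0%N, 0%N, [::]).
exists (fun n => \pi_(controls cU T) (step_control (odflt i0 (unpickle n))))%qT.
move=> v e e0; have [i hi] := step_control_dense (repr v) e0.
by exists (pickle i); rewrite pickleK /= -[v]reprK mdist_pi.
Qed.

End controls_dense.

(** * Measurability on the time square *)

Section plane.
Context {R : realType}.

Lemma R_second_countable : @second_countable R.
Proof. exact: (@second_countable_dense R R rat (@ratr R)) (@ball_ratr R). Qed.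

Lemma plane_second_countable : @second_countable (R * R)%type.
Proof.
pose q (i : rat * rat) : R * R := (ratr i.1, ratr i.2).
apply: (@second_countable_dense R (R * R)%type (rat * rat)%type q) => -[x y] e e0.
have [a xa] := ball_ratr x e0; have [b yb] := ball_ratr y e0.
by exists (a, b); split.
Qed.

(** The product sigma-algebra is generated by rectangles; the countable base of the line makes an
    open set a countable union of them. *)
Lemma open_measurable_plane (W : set (R * R)) : open W ->
  measurable (W : set (measurableTypeR R * measurableTypeR R)).
Proof.
move=> oW; have cid : continuous (fun w : R * R => w) by move=> w; exact: cvg_id.
have := @preimage_pair_second_countable _
  (@measurable _ (measurableTypeR R * measurableTypeR R)%type) R R (R * R)%type
  setT fst snd _ _ _ _ R_second_countable cid.
move=> /(_ _ _ _ _ _ W oW); rewrite setTI (_ : _ @^-1` W = W); last first.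
  by apply/seteqP; split => -[].
apply.
- exact: measurable0.
- by move=> A B; exact: measurableI.
- by move=> G; exact: bigcupT_measurable.
- by move=> V oV; apply: measurable_fst => //; exact: open_measurable.
- by move=> V oV; apply: measurable_snd => //; exact: open_measurable.
Qed.

Lemma time_square_measurable (T : R) :
  measurable (time_square T : set (measurableTypeR R * measurableTypeR R)).
Proof. by apply: measurableX; exact: measurable_itv. Qed.

Lemma leb2_time_square (T : R) : 0 < T -> leb2 (time_square T) = (T * T)%:E.
Proof.
move=> T0; have mT := @measurable_itv R `[0, T].
have L : lebesgue_measure (`[0, T]%classic : set R) = T%:E.
  by rewrite lebesgue_measure_itv /= lte_fin T0 -EFinB subr0.
rewrite EFinM -L; exact: product_measure1E.
Qed.

Lemma ae_notin d' (X : measurableType d') (mu : {measure set X -> \bar R}) (N : set X) :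
  mu.-negligible N -> {ae mu, forall p, ~ N p}.
Proof. by apply: negligibleS => p /= /contrapT. Qed.

(** The countable base is that of the plane, so [Y] can be a space of controls or of functions. It
    serves both implications: with [v] the control for sufficiency, and with [v = psi] for the
    sublevel sets of [h]. *)
Lemma leb2_measurable_pair (T : R) (Y Z : topologicalType) (v : R * R -> Y)
    (g : (R * R) * Y -> Z) :
  continuous g -> leb2_measurable T v -> leb2_measurable T (fun p => g (p, v p)).
Proof.
move=> cg mv V oV.
have := @preimage_pair_second_countable _ (completed_algebra_gen leb2) _ _ _
  (time_square T) id v g _ _ _ plane_second_countable cg.
apply => //.
- exact: completed_measurable.
- exact: completedI.
- exact: completed_bigcup.
- move=> W oW; apply: completed_measurable; apply: measurableI.
    exact: time_square_measurable.
  exact: open_measurable_plane.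
Qed.

End plane.

Theorem proposition3p5 (R : realType) (d : nat) (T : R) (T_gt0 : 0 < T)
  (U : metricType R) (cU : compact [set: U])
  (f : 'rV[R]_d -> U -> 'rV[R]_d)
  (f_cont : continuous (uncurry f))
  (f_growth : exists2 m : R, 0 < m &
     forall x u, enorm (f x u) <= m * (1 + enorm x))
  (f_lip : forall K : set 'rV[R]_d, compact K ->
     exists2 l : R, 0 < l &
     forall x y u, K x -> K y -> enorm (f x u - f y u) <= l * enorm (x - y))
  (phi : compactly_supported R d) (psi : R * R -> compactly_supported R d) :
  measurable_selection T (fun tau t => koopman cU T f tau t phi) psi <->
  exists2 u : R * R -> controls cU T, leb2_measurable T u &
    {ae leb2, forall p, time_square T p ->
       (psi p : 'rV[R]_d -> R[i]) = phi \o controlled_flow f (u p) p.1 p.2}.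
Proof.
have T_ge0 := ltW T_gt0.
have FF : Filter (nbhs (almost_everywhere (@leb2 R))) := ae_filter_ringOfSetsType leb2.
(* The added 1 makes the factor at least 1 even for [d = 0], which keeps the constants positive and
   lets [1] be bounded by [sd] in the growth condition. *)
pose sd := Num.sqrt (d%:R : R) + 1.
have sd1 : 1 <= sd by rewrite lerDr sqrtr_ge0.
have enorm_le (x : 'rV[R]_d) : enorm x <= sd * `|x|.
  by apply: le_trans (enorm_rV_norm x) _; rewrite ler_wpM2r // /sd lerDl ler01.
have [m [m0 f_growth']] : exists m : R, 0 < m /\
    forall x u, `|f x u| <= m * (1 + `|x|).
  have [m m0 fm] := f_growth; exists (m * sd); split.
    by rewrite mulr_gt0 // (lt_le_trans ltr01).
  move=> x u; apply: le_trans (rV_norm_enorm _) _; apply: le_trans (fm x u) _.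
  by rewrite -mulrA ler_pM2l // mulrDr mulr1 lerD.
have f_lip' rho : exists2 l : R, 0 < l & forall x y u,
    `|x| <= rho -> `|y| <= rho -> `|f x u - f y u| <= l * `|x - y|.
  have [l l0 fl] := f_lip _ (@rV_ball_compact _ _ rho); exists (l * sd).
    by rewrite mulr_gt0 // (lt_le_trans ltr01).
  move=> x y u xrho yrho; apply: le_trans (rV_norm_enorm _) _.
  by apply: le_trans (fl x y u xrho yrho) _; rewrite -mulrA ler_pM2l.
pose K := @koopman_map _ _ _ _ _ _ T_ge0 cU f_cont m0 f_growth' f_lip' phi.
have KE p u : time_square T p ->
    (K p u : 'rV[R]_d -> R[i]) = phi \o controlled_flow f u p.1 p.2.
  exact: koopman_mapE.
have cK : continuous (fun w : (R * R) * controls cU T => K w.1 w.2).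
  exact: koopman_map_continuous.
split; last first.
  move=> [u mu aeu]; split; last first.
    by apply: filterS aeu => p pu Tp; exists (u p); exact: pu.
  move=> O oO.
  (* [psi] inherits the measurability of [K p (u p)], with which it agrees off the negligible set
     where the almost everywhere identity fails. *)
  have := leb2_measurable_pair cK mu oO; move=> /completed_ae; apply; first exact: aeu.
  apply/seteqP; split => p [[Tp Op] Np]; split => //; split => //=;
    move: Np => /contrapT /(_ Tp) pE;
    have E : psi p = K p (u p) by apply: cs_eq; rewrite pE KE.
    by rewrite E.
  by move: Op; rewrite /= E.
move=> [mpsi aepsi].
(* The step controls need a point of [U]. One exists because the square has positive measure, so
   that the values of the set-valued map are nonempty somewhere. *)
have [u0] : exists u0 : controls cU T, True.
  apply: contrapT => nu.
  have : leb2.-negligible (time_square T).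
    by apply: negligibleS aepsi => p Tp /= /(_ Tp) [u _]; apply: nu; exists u.
  move=> /(measure_negligible (time_square_measurable T)) T2.
  have /eqP := etrans (esym (leb2_time_square T_gt0)) T2.
  by rewrite eqe gt_eqF // mulr_gt0.
move=> _; have [q dq] := controls_dense cU T_ge0 (repr u0 0).
pose h p u := mdist (K p u) (psi p).
have ch p : continuous (h p).
  have -> : h p = (fun w => mdist w.1 w.2) \o (fun v => (K p v, psi p)) by [].
  move=> v; apply: continuous_comp; last exact: continuous_mdist.
  apply: (@cvg_pair _ _ _ (nbhs v) (nbhs (K p v)) (nbhs (psi p))); last exact: cvg_cst.
  have -> : K p = (fun w => K w.1 w.2) \o (fun v => (p, v)) by [].
  apply: continuous_comp; last exact: cK.
  apply: (@cvg_pair _ _ _ (nbhs v) (nbhs p) (nbhs v)); [exact: cvg_cst|exact: cvg_id].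
have hE n j : completed_algebra_gen leb2 (time_square T `&` [set p | h p (q j) < 2^-1 ^+ n]).
  pose g (w : (R * R) * compactly_supported R d) := mdist (K w.1 (q j)) w.2.
  have cg : continuous g.
    have -> : g = (fun w => mdist w.1 w.2) \o (fun w => (K w.1 (q j), w.2)) by [].
    move=> w; apply: continuous_comp; last exact: continuous_mdist.
    apply: (@cvg_pair _ _ _ (nbhs w) (nbhs (K w.1 (q j))) (nbhs w.2)); last exact: cvg_snd.
    have -> : (fun w : (R * R) * compactly_supported R d => K w.1 (q j)) =
      (fun w => K w.1 w.2) \o (fun w => (w.1, q j)) by [].
    apply: continuous_comp; last exact: cK.
    apply: (@cvg_pair _ _ _ (nbhs w) (nbhs w.1) (nbhs (q j))); [exact: cvg_fst|exact: cvg_cst].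
  have oV : open (`]-oo, 2^-1 ^+ n[%classic : set R) by exact: lray_open.
  have := leb2_measurable_pair cg mpsi oV.
  congr (completed_algebra_gen _ _); apply/seteqP; split => p [Tp];
    by rewrite /= in_itv.
have hBN nj : exists B N : set (R * R),
  [/\ measurable (B : set (measurableTypeR R * measurableTypeR R)),
    leb2.-negligible N & B `|` N = time_square T `&` [set p | h p (q nj.2) < 2^-1 ^+ nj.1]].
  by have [B mB [N nN BN]] := hE nj.1 nj.2; exists B, N.
have [B /choice[N BN]] := choice hBN.
have [M [mM M0 NM]] : leb2.-negligible (\bigcup_n \bigcup_j N (n, j)).
  apply: negligible_bigcup => n; apply: negligible_bigcup => j.
  by have [] := BN (n, j).
have nM : leb2.-negligible M by exists M; split.
(* Off M, the Lebesgue-measurable sublevel sets of the h _ (q j) become Borel. *)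
pose D := time_square T `\` M.
have mT := time_square_measurable T.
have mD : measurable (D : set (measurableTypeR R * measurableTypeR R)).
  exact: measurableD.
have Dfin : (leb2 D < +oo)%E.
  apply: (@le_lt_trans _ _ (leb2 (time_square T))); last by rewrite leb2_time_square // ltry.
  by apply: le_measure; rewrite ?inE //; exact: subDsetl.
have h_meas n j : measurable (D `&` [set p | h p (q j) < 2^-1 ^+ n]
    : set (measurableTypeR R * measurableTypeR R)).
  have [mB _ BNE] := BN (n, j).
  have -> : D `&` [set p | h p (q j) < 2^-1 ^+ n] = B (n, j) `\` M.
    rewrite /D setDE setIAC -setDE -BNE; apply/seteqP; split => p.
      by move=> [[//|Np] nMp]; exfalso; apply/nMp/NM; exists n => //; exists j.
    by move=> [Bp nMp]; split => //; left.
  exact: measurableD.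
have [N' nN' [u [mu hu]]] := zero_selection mD Dfin dq (@controls_complete _ _ cU T)
  (fun p v => mdist_ge0 (K p v) (psi p)) ch h_meas.
exists u.
  move=> V oV; apply: (completed_ae (completed_measurable leb2 (mu V oV)) nM).
  by apply/seteqP; split => [p [[[Tp _] Vp] nMp]|p [[Tp Vp] nMp]].
apply: filterS3 aepsi (ae_notin nM) (ae_notin nN') => p pu nMp nN'p Tp.
have [v vE] := pu Tp.
have : K p (u p) = psi p.
  apply: mdist_positivity; apply: hu => //; exists v.
  rewrite (_ : psi p = K p v) ?mdistxx //.
  by apply: cs_eq; rewrite vE KE.
by move=> <-; rewrite KE.
Qed.
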